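(* One round of Algorithm 1 can be carried out in $O(mn\log(mn))$ time (arithmetic operations and comparisons on real numbers). That is, given probability vectors $a\in\mathbb{R}^m$, $b\in\mathbb{R}^n$, distinct index pairs $(i_1,j_1),\dots,(i_k,j_k)$ in $\{1,\dots,m\}\times\{1,\dots,n\}$, a cost matrix $D\in\mathbb{R}^{m\times n}$, a penalty $\rho>0$ and current iterates $Z_t,M_t\in\mathbb{R}^{m\times n}$, the matrices $$X_{t+1}=\mathrm{Proj}_{C_1(a,b)}(Z_t-M_t-\rho^{-1}D),\quad Z_{t+1}=\mathrm{Proj}_{C_2}(X_{t+1}+M_t),\quad M_{t+1}=M_t+X_{t+1}-Z_{t+1}$$ can be computed in $O(mn\log(mn))$ time.
   Context: $C_1(a,b)=\{X\in\mathbb{R}^{m\times n}:X\mathbf{1}_n=a,\ X^T\mathbf{1}_m=b\}$; with $V=(\{1,\dots,m\}\times\{1,\dots,n\})\setminus\{(i_\ell,j_\ell)\}_{\ell=1}^k$, $C_2=\{X\in\mathbb{R}^{m\times n}:X\ge0,\ X_{i_kj_k}\ge\cdots\ge X_{i_1j_1}\ge X_{pq}\ \forall(p,q)\in V\}$. $\mathrm{Proj}_C$ is the Euclidean (Frobenius norm) projection onto $C$. Algorithm 1 is the ADMM iteration that repeats the three displayed updates in order; one round is one execution of the three updates. *)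

(* Defs.v *)
From mathcomp Require Import all_boot all_order all_algebra.
From mathcomp Require Import boolp classical_sets reals exp.

Set Implicit Arguments.
Unset Strict Implicit.
Unset Printing Implicit Defensive.

Import Order.TTheory GRing.Theory Num.Theory.
Local Open Scope classical_set_scope.
Local Open Scope ring_scope.

Definition probability_vector (R : realType) (m : nat) (a : 'cV[R]_m) : Prop :=
  (forall i, 0 <= a i ord0) /\ \sum_i a i ord0 = 1.

Definition C1 (R : realType) (m n : nat) (a : 'cV[R]_m) (b : 'cV[R]_n) :
    set 'M[R]_(m, n) :=
  [set X | X *m const_mx 1 = a /\ X^T *m const_mx 1 = b].

Section OrderConstraints.
Variables (R : realType) (m n k : nat) (idx : 'I_k -> 'I_m * 'I_n).

Definition free_pairs : {set 'I_m * 'I_n} := (~: [set idx l | l : 'I_k])%SET.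

(* The ranks 1, ..., k are numbered 0, ..., k-1 here; for k = 0 only X >= 0
   remains. *)
Definition C2 : set 'M[R]_(m, n) :=
  [set X : 'M[R]_(m, n) | [/\ forall p q, 0 <= X p q,
     forall l l' : 'I_k, l' = l.+1 :> nat ->
       X (idx l).1 (idx l).2 <= X (idx l').1 (idx l').2
   & forall l : 'I_k, l = 0%N :> nat -> forall p q, (p, q) \in free_pairs ->
       X p q <= X (idx l).1 (idx l).2]].

End OrderConstraints.

(* The canonical norm of MathComp-Analysis on matrices is the sup norm. *)
Definition frobenius (R : realType) (m n : nat) (X : 'M[R]_(m, n)) : R :=
  Num.sqrt (\sum_i \sum_j X i j ^+ 2).

(* Meaningful when the closest point exists and is unique, in particular for
   C nonempty, closed and convex; [xget 0] is choice, with value 0 on the empty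
   set. *)
Definition Proj (R : realType) (m n : nat) (C : set 'M[R]_(m, n))
    (Y : 'M[R]_(m, n)) : 'M[R]_(m, n) :=
  xget 0 [set X | C X /\ forall W, C W -> frobenius (Y - X) <= frobenius (Y - W)].

Definition admm_X (R : realType) (m n : nat) (a : 'cV[R]_m) (b : 'cV[R]_n)
    (D : 'M[R]_(m, n)) (rho : R) (Z M : 'M[R]_(m, n)) : 'M[R]_(m, n) :=
  Proj (C1 a b) (Z - M - rho^-1 *: D).

Definition admm_Z (R : realType) (m n k : nat) (idx : 'I_k -> 'I_m * 'I_n)
    (X M : 'M[R]_(m, n)) : 'M[R]_(m, n) :=
  Proj (C2 idx) (X + M).

Definition admm_M (R : realType) (m n : nat) (X Z M : 'M[R]_(m, n)) :
    'M[R]_(m, n) :=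
  M + X - Z.

(* Real RAM, in structured form.  The memory consists of scalar variables and
   infinite arrays, for natural numbers (control and addressing) and for
   reals.  A program is a finite syntax tree, hence fixed once and for all
   independently of the input and its size.  Its only real constants are 0 and
   1, there is no conversion between reals and naturals, and naturals only
   have addition and truncated subtraction, so that no computation can be
   hidden in large integers or in a rounding operation. *)

Inductive nexp : Type :=
  | NConst of nat
  | NVar of nat
  | NGet of nat & nexp
  | NAdd of nexp & nexp
  | NSub of nexp & nexp.

Inductive rexp : Type :=
  | RZero
  | ROne
  | RVar of nat
  | RGet of nat & nexp
  | RAdd of rexp & rexp
  | RSub of rexp & rexp
  | RMul of rexp & rexp
  | RDiv of rexp & rexp.

Inductive bexp : Type :=
  | BNle of nexp & nexp
  | BRle of rexp & rexp
  | BNot of bexp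
  | BAnd of bexp & bexp.

Inductive cmd : Type :=
  | Skip
  | NSet of nat & nexp
  | NPut of nat & nexp & nexp
  | RSet of nat & rexp
  | RPut of nat & nexp & rexp
  | Seq of cmd & cmd
  | If of bexp & cmd & cmd
  | While of bexp & cmd.

Record state (R : realType) : Type := State {
  nvar : nat -> nat;
  narr : nat -> nat -> nat;
  rvar : nat -> R;
  rarr : nat -> nat -> R }.

Section Semantics.
Variable R : realType.
Implicit Type s : state R.

Definition upd (T : Type) (f : nat -> T) (x : nat) (v : T) : nat -> T :=
  [eta f with x |-> v].

Definition upd_arr (T : Type) (f : nat -> nat -> T) (r i : nat) (v : T) :=
  upd f r (upd (f r) i v).

Fixpoint neval s (e : nexp) : nat :=
  match e with
  | NConst c => c
  | NVar x => nvar s x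
  | NGet r e => narr s r (neval s e)
  | NAdd e1 e2 => (neval s e1 + neval s e2)%N
  | NSub e1 e2 => (neval s e1 - neval s e2)%N
  end.

Fixpoint reval s (e : rexp) : R :=
  match e with
  | RZero => 0
  | ROne => 1
  | RVar x => rvar s x
  | RGet r e => rarr s r (neval s e)
  | RAdd e1 e2 => reval s e1 + reval s e2
  | RSub e1 e2 => reval s e1 - reval s e2
  | RMul e1 e2 => reval s e1 * reval s e2
  | RDiv e1 e2 => reval s e1 / reval s e2
  end.

Fixpoint beval s (e : bexp) : bool :=
  match e with
  | BNle e1 e2 => (neval s e1 <= neval s e2)%N
  | BRle e1 e2 => reval s e1 <= reval s e2
  | BNot e => ~~ beval s e
  | BAnd e1 e2 => beval s e1 && beval s e2
  end.

(* Every constant, memory access, arithmetic operation, comparison and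
   connective costs one unit of time; [BAnd] evaluates both arguments. *)
Fixpoint ncost (e : nexp) : nat :=
  match e with
  | NConst _ | NVar _ => 1
  | NGet _ e => (ncost e).+1
  | NAdd e1 e2 | NSub e1 e2 => (ncost e1 + ncost e2).+1
  end.

Fixpoint rcost (e : rexp) : nat :=
  match e with
  | RZero | ROne | RVar _ => 1
  | RGet _ e => (ncost e).+1
  | RAdd e1 e2 | RSub e1 e2 | RMul e1 e2 | RDiv e1 e2 =>
      (rcost e1 + rcost e2).+1
  end.

Fixpoint bcost (e : bexp) : nat :=
  match e with
  | BNle e1 e2 => (ncost e1 + ncost e2).+1
  | BRle e1 e2 => (rcost e1 + rcost e2).+1
  | BNot e => (bcost e).+1
  | BAnd e1 e2 => (bcost e1 + bcost e2).+1
  end.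

(* [exec c s t s']: started in s, c halts in s' after t units of time. *)
Inductive exec : cmd -> state R -> nat -> state R -> Prop :=
  | exec_skip s : exec Skip s 1 s
  | exec_nset s x e :
      exec (NSet x e) s (ncost e).+1
        (State (upd (nvar s) x (neval s e)) (narr s) (rvar s) (rarr s))
  | exec_nput s r i e :
      exec (NPut r i e) s (ncost i + ncost e).+1
        (State (nvar s) (upd_arr (narr s) r (neval s i) (neval s e))
               (rvar s) (rarr s))
  | exec_rset s x e :
      exec (RSet x e) s (rcost e).+1
        (State (nvar s) (narr s) (upd (rvar s) x (reval s e)) (rarr s))
  | exec_rput s r i e :
      exec (RPut r i e) s (ncost i + rcost e).+1
        (State (nvar s) (narr s) (rvar s)
               (upd_arr (rarr s) r (neval s i) (reval s e)))
  | exec_seq s1 s2 s3 c1 c2 t1 t2 :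
      exec c1 s1 t1 s2 -> exec c2 s2 t2 s3 ->
      exec (Seq c1 c2) s1 (t1 + t2)%N s3
  | exec_if s s' b c1 c2 t :
      exec (if beval s b then c1 else c2) s t s' ->
      exec (If b c1 c2) s (bcost b + t).+1 s'
  | exec_while_false s b c :
      ~~ beval s b -> exec (While b c) s (bcost b).+1 s
  | exec_while_true s1 s2 s3 b c t1 t2 :
      beval s1 b -> exec c s1 t1 s2 -> exec (While b c) s2 t2 s3 ->
      exec (While b c) s1 (bcost b + t1 + t2).+1 s3.

(* Row-major storage; a column vector occupies the cells 0, ..., m-1. *)
Definition stores s (r m n : nat) (A : 'M[R]_(m, n)) : Prop :=
  forall (i : 'I_m) (j : 'I_n), rarr s r (i * n + j)%N = A i j.

(* Nothing is assumed about the rest of the memory. *)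
Definition admm_input s (m n k : nat) (a : 'cV[R]_m) (b : 'cV[R]_n)
    (idx : 'I_k -> 'I_m * 'I_n) (D : 'M[R]_(m, n)) (rho : R)
    (Z M : 'M[R]_(m, n)) : Prop :=
  [/\ [/\ nvar s 0 = m, nvar s 1 = n & nvar s 2 = k],
      forall l : 'I_k, narr s 0 l = (idx l).1 /\ narr s 1 l = (idx l).2,
      rvar s 0 = rho
    & [/\ stores s 0 a, stores s 1 b, stores s 2 D, stores s 3 Z
        & stores s 4 M]].

Definition admm_output s (m n : nat) (X Z M : 'M[R]_(m, n)) : Prop :=
  [/\ stores s 5 X, stores s 6 Z & stores s 7 M].

End Semantics.

(* Main.v *)
(* X' is explicit: subtracting from Y the residuals of its row and column sums,
   spread evenly over the rows and columns, changes Y by a matrix of the form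
   (u_i + v_j), which is orthogonal to the directions of C1.
   For Z', list the entries of X' + M in increasing order on the free pairs,
   followed by the entries i_1j_1, ..., i_kj_k. The projection onto C2 is the
   isotonic regression of this sequence, clipped at 0: on the sorted free part
   the residuals of the regression are nonnegative, so that it does not matter
   that C2 only bounds the free entries by the first ranked one. Sorting takes
   O(N log N) steps for N = mn. The regression consists of the slopes of the
   greatest convex minorant of the partial sums, which a Graham scan finds in
   linear time, and Abel summation yields the variational inequality. *)
Require Import Defs.
From mathcomp Require Import all_boot all_order all_algebra.
From mathcomp Require Import boolp classical_sets reals exp.
From mathcomp Require Import zify ring lra.

Set Implicit Arguments.
Unset Strict Implicit.
Unset Printing Implicit Defensive.

Import Order.TTheory GRing.Theory Num.Theory.
Local Open Scope ring_scope.

(** * Running structured programs *)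

Section Programs.
Variable R : realType.
Implicit Types (s : state R) (c : cmd).

(** The machine model shapes the proof. Naturals cannot be multiplied, divided or converted to
    reals, so [mn], the row offsets, the row and column of a position and the real copies of the
    indices are all maintained by repeated addition. There is no recursion, hence a bottom-up merge
    sort; and loops that are linear only in total, such as the hull scan, are flattened so that
    every iteration takes constant time and lowers a variant by at least one. A single lexicographic
    order, by rank and then by value with rank 0 on the free pairs, lets one sort produce the whole
    sequence to be regressed. Postconditions mention only what a phase computes; the rest of the
    memory is recovered from the syntactic set of registers written. Costs stay explicit functions
    of the dimensions and are compared with [N * ln N] only at the end. *)

Fixpoint loop_free c : bool :=
  match c with
  | Seq c1 c2 | If _ c1 c2 => loop_free c1 && loop_free c2
  | While _ _ => false
  | _ => true
  end.

(* The values of [run] and [run_cost] on loops are junk. *)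
Fixpoint run c s : state R :=
  match c with
  | Skip | While _ _ => s
  | NSet x e => State (upd (nvar s) x (neval s e)) (narr s) (rvar s) (rarr s)
  | NPut r i e =>
      State (nvar s) (upd_arr (narr s) r (neval s i) (neval s e)) (rvar s)
            (rarr s)
  | RSet x e => State (nvar s) (narr s) (upd (rvar s) x (reval s e)) (rarr s)
  | RPut r i e =>
      State (nvar s) (narr s) (rvar s)
            (upd_arr (rarr s) r (neval s i) (reval s e))
  | Seq c1 c2 => run c2 (run c1 s)
  | If b c1 c2 => if beval s b then run c1 s else run c2 s
  end.

Fixpoint run_cost c : nat :=
  match c with
  | Skip | While _ _ => 1
  | NSet _ e => (ncost e).+1
  | NPut _ i e => (ncost i + ncost e).+1
  | RSet _ e => (rcost e).+1
  | RPut _ i e => (ncost i + rcost e).+1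
  | Seq c1 c2 => run_cost c1 + run_cost c2
  | If b c1 c2 => (bcost b + (run_cost c1 + run_cost c2)).+1
  end.

Fixpoint wr_nvar c (x : nat) : bool :=
  match c with
  | NSet y _ => y == x
  | Seq c1 c2 | If _ c1 c2 => wr_nvar c1 x || wr_nvar c2 x
  | While _ c => wr_nvar c x
  | _ => false
  end.

Fixpoint wr_narr c (r : nat) : bool :=
  match c with
  | NPut q _ _ => q == r
  | Seq c1 c2 | If _ c1 c2 => wr_narr c1 r || wr_narr c2 r
  | While _ c => wr_narr c r
  | _ => false
  end.

Fixpoint wr_rvar c (x : nat) : bool :=
  match c with
  | RSet y _ => y == x
  | Seq c1 c2 | If _ c1 c2 => wr_rvar c1 x || wr_rvar c2 x
  | While _ c => wr_rvar c x
  | _ => false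
  end.

Fixpoint wr_rarr c (r : nat) : bool :=
  match c with
  | RPut q _ _ => q == r
  | Seq c1 c2 | If _ c1 c2 => wr_rarr c1 r || wr_rarr c2 r
  | While _ c => wr_rarr c r
  | _ => false
  end.

Record same c s s' : Prop := Same {
  same_nvar : forall x, ~~ wr_nvar c x -> nvar s' x = nvar s x;
  same_narr : forall r, ~~ wr_narr c r -> narr s' r = narr s r;
  same_rvar : forall x, ~~ wr_rvar c x -> rvar s' x = rvar s x;
  same_rarr : forall r, ~~ wr_rarr c r -> rarr s' r = rarr s r }.

Lemma upd_neq T (f : nat -> T) x v y : x != y -> upd f x v y = f y.
Proof. by rewrite /upd /= eq_sym => /negPf ->. Qed.

Lemma same_seq c1 c2 (s1 s2 s3 : state R) :
  same c1 s1 s2 -> same c2 s2 s3 -> same (Seq c1 c2) s1 s3.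
Proof.
move=> [a1 a2 a3 a4] [b1 b2 b3 b4].
by split=> x /=; rewrite negb_or => /andP[? ?];
  rewrite ?b1 ?b2 ?b3 ?b4 ?a1 ?a2 ?a3 ?a4.
Qed.

Lemma exec_same c s t s' : exec c s t s' -> same c s s'.
Proof.
elim=> {c s t s'} //=.
- by move=> s x e; split=> //= y; exact: upd_neq.
- by move=> s r i e; split=> //= y; exact: upd_neq.
- by move=> s x e; split=> //= y; exact: upd_neq.
- by move=> s r i e; split=> //= y; exact: upd_neq.
- by move=> s1 s2 s3 c1 c2 t1 t2 _ + _; exact: same_seq.
- move=> s s' b c1 c2 t _ [a1 a2 a3 a4].
  by split=> x /=; rewrite negb_or => /andP[? ?];
    rewrite ?a1 ?a2 ?a3 ?a4 //; case: ifP.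
- move=> s1 s2 s3 b c t1 t2 _ _ [a1 a2 a3 a4] _ [b1 b2 b3 b4].
  by split=> x /= ?; rewrite ?b1 ?b2 ?b3 ?b4 ?a1 ?a2 ?a3 ?a4.
Qed.

(** Total correctness with a time bound; since executions are relational, halting is part of the
    claim. *)
Definition reach c s T (Q : state R -> Prop) : Prop :=
  exists t s', [/\ exec c s t s', (t <= T)%N & Q s'].

Lemma reach_weaken c s T T' (Q Q' : state R -> Prop) :
  reach c s T Q -> (T <= T')%N ->
  (forall s', same c s s' -> Q s' -> Q' s') -> reach c s T' Q'.
Proof.
move=> [t [s' [e l q]]] lT QQ; exists t, s'; split=> //.
  exact: leq_trans lT.
exact: QQ (exec_same e) q.
Qed.

(** [run_cost] adds up both branches of a conditional, which makes the bound independent of the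
    state. *)
Lemma exec_run c s : loop_free c ->
  exists t, exec c s t (run c s) /\ (t <= run_cost c)%N.
Proof.
elim: c s => //=.
- by move=> s _; exists 1%N; split=> //; constructor.
- by move=> x e s _; eexists; split; first by constructor.
- by move=> r i e s _; eexists; split; first by constructor.
- by move=> x e s _; eexists; split; first by constructor.
- by move=> r i e s _; eexists; split; first by constructor.
- move=> c1 IH1 c2 IH2 s /andP[/IH1 H1 /IH2 H2].
  have [t1 [e1 l1]] := H1 s; have [t2 [e2 l2]] := H2 (run c1 s).
  exists (t1 + t2)%N; split; last exact: leq_add.
  exact: exec_seq e1 e2.
- move=> b c1 IH1 c2 IH2 s /andP[/IH1 H1 /IH2 H2].
  have [t1 [e1 l1]] := H1 s; have [t2 [e2 l2]] := H2 s.
  exists (bcost b + if beval s b then t1 else t2).+1; split.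
    by apply: exec_if; case: (beval s b).
  rewrite ltnS leq_add2l; case: (beval s b).
    exact: leq_trans l1 (leq_addr _ _).
  exact: leq_trans l2 (leq_addl _ _).
Qed.

Lemma reach_run c s (Q : state R -> Prop) :
  loop_free c -> Q (run c s) -> reach c s (run_cost c) Q.
Proof. by move=> /(exec_run s)[t [e l]] q; exists t, (run c s). Qed.

Lemma reach_seq c1 c2 s T1 T2 (Q1 Q2 : state R -> Prop) :
  reach c1 s T1 Q1 ->
  (forall s', same c1 s s' -> Q1 s' -> reach c2 s' T2 Q2) ->
  reach (Seq c1 c2) s (T1 + T2) Q2.
Proof.
move=> [t1 [s1 [e1 l1 q1]]] H.
have [t2 [s2 [e2 l2 q2]]] := H _ (exec_same e1) q1.
exists (t1 + t2)%N, s2; split=> //; last exact: leq_add.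
exact: exec_seq e1 e2.
Qed.

(* [I d s] carries a bound d on the number of remaining iterations. *)
Lemma reach_while b c s0 d0 K (I : nat -> state R -> Prop) :
  I d0 s0 ->
  (forall d s, same c s0 s -> I d s -> beval s b ->
    reach c s K (fun s' => exists2 d', (d' < d)%N & I d' s')) ->
  reach (While b c) s0 (d0.+1 * (bcost b + K).+1)%N
    (fun s' => ~~ beval s' b /\ exists d, I d s').
Proof.
move=> i0 H; have sm0 : same c s0 s0 by split.
suff : forall d s, same c s0 s -> I d s -> reach (While b c) s (d.+1 * (bcost b + K).+1)%N
    (fun s' => ~~ beval s' b /\ exists d, I d s') by apply.
elim/ltn_ind=> d IH s sm i; have [bs|bs] := boolP (beval s b); last first.
  exists (bcost b).+1, s; split; [exact: exec_while_false| |by split=> //; exists d].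
  by rewrite mulSn -addSn; lia.
have [t1 [s1 [e1 l1 [d' ld i1]]]] := H _ _ sm i bs.
have sm1 : same c s0 s1.
  have [a1 a2 a3 a4] := sm; have [b1 b2 b3 b4] := exec_same e1.
  by split=> x w; rewrite ?b1 ?b2 ?b3 ?b4 ?a1 ?a2 ?a3 ?a4.
have [t2 [s2 [e2 l2 q2]]] := IH _ ld _ sm1 i1.
exists (bcost b + t1 + t2).+1, s2; split=> //.
  exact: exec_while_true e1 e2.
have : (d'.+1 * (bcost b + K).+1 <= d * (bcost b + K).+1)%N by rewrite leq_mul2r ld orbT.
by rewrite [(d.+1 * _)%N]mulSn; lia.
Qed.

Lemma reach_for b c s0 d0 (I : nat -> state R -> Prop) :
  loop_free c -> I d0 s0 ->
  (forall d s, same c s0 s -> I d s -> beval s b ->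
     exists2 d', (d' < d)%N & I d' (run c s)) ->
  reach (While b c) s0 (d0.+1 * (bcost b + run_cost c).+1)%N
    (fun s' => ~~ beval s' b /\ exists d, I d s').
Proof.
move=> lf i0 H; apply: reach_while => // d s sm i bs.
by apply: reach_run => //; exact: H.
Qed.

Definition for_cost c0 b c d := (run_cost c0 + d.+1 * (bcost b + run_cost c).+1)%N.

(** Step and exit both see [same] from the state before initialization, so an invariant need only
    mention what the loop changes. *)
Lemma reach_for_init c0 b c (s : state R) d0 (I : nat -> state R -> Prop) (Q : state R -> Prop) :
  loop_free c0 && loop_free c -> I d0 (run c0 s) ->
  (forall d s', same (Seq c0 (While b c)) s s' -> I d s' -> beval s' b ->
     exists2 d', (d' < d)%N & I d' (run c s')) ->
  (forall d s', same (Seq c0 (While b c)) s s' -> I d s' -> ~~ beval s' b -> Q s') ->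
  reach (Seq c0 (While b c)) s (for_cost c0 b c d0) Q.
Proof.
move=> /andP[lf0 lf] i0 step post.
have [t0 [e0 l0]] := exec_run s lf0.
have sm s' : same c (run c0 s) s' -> same (Seq c0 (While b c)) s s'.
  by move=> /(same_seq (exec_same e0)); case=> a1 a2 a3 a4; split.
have := reach_for (b := b) lf i0 (fun d s' h => step d s' (sm s' h)).
move=> [t [s' [e l [bs [d id]]]]].
exists (t0 + t)%N, s'; split; [exact: exec_seq e0 e|exact: leq_add|].
by apply: post id bs; apply: sm; case: (exec_same e) => *; split.
Qed.

End Programs.

(** * Euclidean projections *)

Section Projections.
Variable R : realType.

(** The variational inequality yields more than minimality: expanding the square leaves the extra
    term [sq (W - X)], which gives the uniqueness needed to identify the point chosen by [xget].
    Convexity of C does not enter. *)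
Lemma Proj_eq m n (C : set 'M[R]_(m, n)) (Y X : 'M[R]_(m, n)) :
  C X -> (forall W, C W -> \sum_i \sum_j (Y i j - X i j) * (W i j - X i j) <= 0) ->
  Proj C Y = X.
Proof.
move=> CX H; pose sq (V : 'M[R]_(m, n)) := \sum_i \sum_j V i j ^+ 2.
have sq0 V : 0 <= sq V by do 2![apply: sumr_ge0 => ? _]; exact: sqr_ge0.
have frE V : frobenius V = Num.sqrt (sq V) by [].
have key W : C W -> sq (Y - X) + sq (W - X) <= sq (Y - W).
  move=> CW; have -> : sq (Y - W) = sq (Y - X) + sq (W - X)
    - 2 * \sum_i \sum_j (Y i j - X i j) * (W i j - X i j).
    rewrite /sq mulr_sumr -sumrN -!big_split /=; apply: eq_bigr => i _.
    rewrite mulr_sumr -sumrN -!big_split /=; apply: eq_bigr => j _.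
    by rewrite !mxE; ring.
  by have := H _ CW; lra.
apply: xget_subset1.
  split=> // W CW; rewrite !frE ler_sqrt //.
  by apply: le_trans (key W CW); rewrite lerDl.
suff uniqX V : C V -> (forall W, C W -> frobenius (Y - V) <= frobenius (Y - W)) -> V = X.
  by move=> V1 V2 [c1 p1] [c2 p2]; rewrite (uniqX V1) // (uniqX V2).
move=> CV /(_ X CX); rewrite !frE ler_sqrt // => lVX.
have /eqP : sq (V - X) = 0.
  by apply/le_anti/andP; split=> //; have := key _ CV; lra.
rewrite psumr_eq0 => [|i _]; last by apply: sumr_ge0 => j _; exact: sqr_ge0.
move=> /allP z; apply/matrixP => i j; apply/eqP.
have := z i (mem_index_enum i); rewrite psumr_eq0 => [|? _]; last exact: sqr_ge0.
by move=> /allP/(_ j (mem_index_enum j)); rewrite !mxE sqrf_eq0 subr_eq0.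
Qed.

Definition res_row m n (Y : 'M[R]_(m, n)) (a : 'cV[R]_m) i := a i ord0 - \sum_j Y i j.
Definition res_col m n (Y : 'M[R]_(m, n)) (b : 'cV[R]_n) j := b j ord0 - \sum_i Y i j.

(** Spreading the row and the column residuals corrects the total twice, and the last term takes one
    copy back. Both residual vectors have the same sum, since a and b both sum to 1. *)
Lemma Proj_C1 m n (a : 'cV[R]_m) (b : 'cV[R]_n) (Y : 'M[R]_(m, n)) :
  (0 < m)%N -> (0 < n)%N ->
  \sum_i a i ord0 = 1 -> \sum_i b i ord0 = 1 ->
  Proj (C1 a b) Y = \matrix_(i, j)
    (Y i j + res_row Y a i / n%:R + res_col Y b j / m%:R
      - (1 - \sum_i \sum_j Y i j) / (n%:R * m%:R)).
Proof.
move=> m0 n0 a1 b1; set s := 1 - _.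
have mR : m%:R != 0 :> R by rewrite pnatr_eq0 -lt0n.
have nR : n%:R != 0 :> R by rewrite pnatr_eq0 -lt0n.
have sr : \sum_i res_row Y a i = s by rewrite sumrB a1.
have sc : \sum_j res_col Y b j = s by rewrite sumrB b1 exchange_big.
have cst p (x : R) : \sum_(i < p) x = p%:R * x.
  by rewrite sumr_const card_ord mulr_natl.
have mulE p q (V : 'M[R]_(p, q)) (c : 'cV[R]_p) :
    V *m const_mx 1 = c <-> forall i, \sum_j V i j = c i ord0.
  split=> [<- i|H]; first by rewrite mxE; apply: eq_bigr => j _; rewrite mxE mulr1.
  apply/matrixP => i j; rewrite mxE (ord1 j) -H.
  by apply: eq_bigr => l _; rewrite mxE mulr1.
apply: Proj_eq.
  split; apply/mulE => i.
    under eq_bigr do rewrite mxE.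
    rewrite sumrB !big_split /= !cst -mulr_suml sc.
    by rewrite /res_row; field; rewrite mR nR.
  under eq_bigr do rewrite !mxE.
  rewrite sumrB !big_split /= !cst -mulr_suml sr.
  by rewrite /res_col; field; rewrite mR nR.
set X := \matrix_(_, _) _ => W [/mulE rW /mulE cW].
have rX i : \sum_j (W i j - X i j) = 0.
  rewrite sumrB rW; under [X in _ - X]eq_bigr do rewrite mxE.
  rewrite sumrB !big_split /= !cst -mulr_suml sc.
  by rewrite /res_row; field; rewrite mR nR.
have cX j : \sum_i (W i j - X i j) = 0.
  have := cW j; under eq_bigr do rewrite mxE.
  rewrite sumrB => ->; under [X in _ - X]eq_bigr do rewrite mxE.
  rewrite sumrB !big_split /= !cst -mulr_suml sr.
  by rewrite /res_col; field; rewrite mR nR.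
rewrite (eq_bigr (fun i => \sum_j (s / (n%:R * m%:R) - res_row Y a i / n%:R) * (W i j - X i j)
   + \sum_j - (res_col Y b j / m%:R) * (W i j - X i j))); last first.
  move=> i _; rewrite -big_split /=; apply: eq_bigr => j _.
  by rewrite [X i j]mxE; ring.
rewrite big_split /= big1 => [|i _]; last by rewrite -mulr_sumr rX mulr0.
rewrite exchange_big big1 ?addr0 // => j _.
by rewrite -mulr_sumr cX mulr0.
Qed.

End Projections.

(** * Isotonic regression and lower convex hulls *)

Section Isotonic.
Variable R : realType.
Implicit Types x f g F : nat -> R.

Lemma abel_sum (d h : nat -> R) N :
  \sum_(t < N.+1) d t * h t =
  (\sum_(t < N.+1) d t) * h N
  - \sum_(t < N) (\sum_(u < t.+1) d u) * (h t.+1 - h t).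
Proof.
elim: N => [|N IH]; first by rewrite !big_ord_recr !big_ord0 /=; ring.
rewrite big_ord_recr /= IH [\sum_(t < N.+2) d t]big_ord_recr /=.
rewrite [\sum_(t < N.+1) (\sum_(u < t.+1) d u) * _]big_ord_recr /=; ring.
Qed.

(** The optimality conditions of isotonic regression: the partial sums of the residual x - f are the
    multipliers of the constraints [f t <= f t.+1], hence nonnegative, and zero wherever f jumps. *)
Record isotonic N x f : Prop := Isotonic {
  iso_mono : forall t, (t.+1 < N)%N -> f t <= f t.+1;
  iso_ge0 : forall r, (r <= N)%N -> 0 <= \sum_(t < r) (x t - f t);
  iso_total : \sum_(t < N) (x t - f t) = 0;
  iso_slack : forall t, (t.+1 < N)%N ->
    \sum_(u < t.+1) (x u - f u) = 0 \/ f t.+1 = f t }.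

Lemma mono_nat N g : (forall t, (t.+1 < N)%N -> g t <= g t.+1) ->
  forall t u, (t <= u)%N -> (u < N)%N -> g t <= g u.
Proof.
move=> H t u; elim: u => [|u IH]; first by rewrite leqn0 => /eqP ->.
rewrite leq_eqVlt => /predU1P[->//|]; rewrite ltnS => /IH tu uN.
exact: le_trans (tu (ltnW uN)) (H _ uN).
Qed.

(* Entries in [fr] are only bounded by the remaining ones. Since x is sorted
   there, their residual is nonnegative, so g may be replaced by g'. *)
Lemma isotonic_clip_le0 N x f g g' (fr : pred nat) :
  isotonic N x f ->
  (forall t, (t.+1 < N)%N -> fr t.+1 -> fr t /\ x t <= x t.+1) ->
  (forall t, (t.+1 < N)%N -> g' t <= g' t.+1) ->
  (forall t, (t < N)%N -> 0 <= g t) ->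
  (forall t, (t < N)%N -> fr t -> g t <= g' t) ->
  (forall t, (t < N)%N -> ~~ fr t -> g t = g' t) ->
  \sum_(t < N) (x t - Num.max (f t) 0) * (g t - Num.max (f t) 0) <= 0.
Proof.
case: N => [|N] [fm S0 SN Ss] xs gm g0 gg' gE; first by rewrite big_ord0.
pose d t := x t - f t; pose f' t := Num.max (f t) 0.
(* Either the preceding partial sum vanishes, and the residual equals the next partial sum, or f is
   constant there while x does not decrease. *)
have d0 t : (t < N.+1)%N -> fr t -> 0 <= d t.
  elim: t => [|t IH] tN frt.
    by have := S0 1%N isT; rewrite big_ord1.
  have [frt' xt] := xs _ tN frt.
  have [St|ft] := Ss _ tN.
    by have := S0 t.+2 tN; rewrite big_ord_recr /= St add0r.
  by apply: le_trans (IH (ltnW tN) frt') _; rewrite /d ft lerD2r.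
have dh h : (forall t, (t < N)%N -> 0 <= h t.+1 - h t) -> \sum_(t < N.+1) d t * h t <= 0.
  move=> hm; rewrite abel_sum /d SN mul0r sub0r oppr_le0 sumr_ge0 // => t _.
  by rewrite mulr_ge0 ?S0 ?hm // ltnW // ltnS ltn_ord.
(* Complementary slackness survives clipping: where f is constant, so is its clipped version. *)
have df : \sum_(t < N.+1) d t * f' t = 0.
  rewrite abel_sum /d SN mul0r sub0r big1 ?oppr0 // => t _.
  have [->|e] := Ss t (ltn_ord t); first by rewrite mul0r.
  by rewrite /f' e subrr mulr0.
(* Split x - f' as d + (f - f'): d is paired as in the unclipped regression, while f - f' is nonzero
   only where f < 0 and f' = 0, so that g >= 0 settles the sign. *)
have : \sum_(t < N.+1) (x t - f' t) * (g t - f' t) + \sum_(t < N.+1) d t * f' t =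
    \sum_(t < N.+1) d t * g t + \sum_(t < N.+1) (f t - f' t) * (g t - f' t).
  by rewrite -!big_split /=; apply: eq_bigr => t _; rewrite /d; ring.
rewrite df addr0 => ->.
have lt1 : \sum_(t < N.+1) d t * g t <= 0.
  apply: le_trans (dh g' _); last by move=> t tN; rewrite subr_ge0 gm.
  apply: ler_sum => t _; have [frt|nfr] := boolP (fr t); last by rewrite gE.
  by rewrite ler_wpM2l ?d0 ?gg'.
have lt2 : \sum_(t < N.+1) (f t - f' t) * (g t - f' t) <= 0.
  apply: sumr_le0 => t _; rewrite /f'.
  have := g0 t (ltn_ord t); case: (leP (f t) 0) => ft gt; last by rewrite subrr mul0r.
  by rewrite !subr0 mulr_le0_ge0.
by rewrite -[X in _ <= X]addr0 lerD.
Qed.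

Definition slope F (a b : nat) : R := (F b - F a) / (b%:R - a%:R).

Definition above_chord F (a b : nat) : Prop :=
  forall r, (a <= r <= b)%N -> F a + (r%:R - a%:R) * slope F a b <= F r.

Lemma above_succ F a : above_chord F a a.+1.
Proof.
move=> r; case: (eqVneq r a) => [->|ra] lr; first by rewrite subrr mul0r addr0.
have -> : r = a.+1 by lia.
rewrite /slope mulrC divfK; first by rewrite addrC subrK.
by rewrite -natrB // subSnn oner_eq0.
Qed.

Lemma slopeE F a b : (a < b)%N -> F b = F a + (b%:R - a%:R) * slope F a b.
Proof.
move=> ab; have ab' : (b%:R - a%:R : R) != 0 by rewrite subr_eq0 eqr_nat; lia.
by rewrite /slope mulrC divfK // addrC subrK.
Qed.

(** The slope over [a, c] is a weighted mean of the two others and so lies between them; with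
    decreasing slopes the long chord runs below both short ones. *)
Lemma above_trans F a b c : (a < b)%N -> (b < c)%N ->
  slope F b c <= slope F a b -> above_chord F a b -> above_chord F b c -> above_chord F a c.
Proof.
move=> ab bc ls H1 H2 r /andP[ar rc].
have Eb := slopeE F ab; have Ec := slopeE F bc.
have Ec' := slopeE F (ltn_trans ab bc).
have ab' : (a%:R < b%:R :> R) by rewrite ltr_nat.
have bc' : (b%:R < c%:R :> R) by rewrite ltr_nat.
have ar' : (a%:R <= r%:R :> R) by rewrite ler_nat.
have rc' : (r%:R <= c%:R :> R) by rewrite ler_nat.
move: ls Eb Ec Ec' (H1 r) (H2 r).
set s1 := slope F a b; set s2 := slope F b c; set s3 := slope F a c.
move=> ls Eb Ec Ec' h1 h2.
have s3E : (c%:R - a%:R) * s3 = (b%:R - a%:R) * s1 + (c%:R - b%:R) * s2 by lra.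
have s31 : s3 <= s1.
  have : 0 <= (c%:R - b%:R) * (s1 - s2) by rewrite mulr_ge0; lra.
  have ca : 0 < c%:R - a%:R :> R by lra.
  move=> p; rewrite -(ler_pM2l ca); lra.
have s32 : s2 <= s3.
  have : 0 <= (b%:R - a%:R) * (s1 - s2) by rewrite mulr_ge0; lra.
  have ca : 0 < c%:R - a%:R :> R by lra.
  move=> p; rewrite -(ler_pM2l ca); lra.
have [rb|br] := leqP r b.
  have {}h1 := h1 (introT andP (conj ar rb)).
  have : 0 <= (r%:R - a%:R) * (s1 - s3) by rewrite mulr_ge0; lra.
  lra.
have {}h2 := h2 (introT andP (conj (ltnW br) rc)).
have : 0 <= (c%:R - r%:R) * (s3 - s2) by rewrite mulr_ge0; lra.
lra.
Qed.

(* The vertices st 0 < ... < st h of the lower convex hull of the points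
   (r, F r) for r <= st h. *)
Record hull F (st : nat -> nat) h : Prop := Hull {
  hull0 : st 0%N = 0%N;
  hull_lt : forall b, (b < h)%N -> (st b < st b.+1)%N;
  hull_above : forall b, (b < h)%N -> above_chord F (st b) (st b.+1);
  hull_slope : forall b, (b.+1 < h)%N ->
    slope F (st b) (st b.+1) <= slope F (st b.+1) (st b.+2) }.

Lemma hull_mono F st h b c : hull F st h -> (c <= b)%N -> (b <= h)%N -> (st c <= st b)%N.
Proof.
move=> [_ H1 _ _]; elim: b => [|b IH]; first by rewrite leqn0 => /eqP ->.
rewrite leq_eqVlt => /predU1P[->//|]; rewrite ltnS => cb bh.
exact: leq_trans (IH cb (ltnW bh)) (ltnW (H1 _ bh)).
Qed.

(** While vertices are being popped, the chord to q may violate convexity; only its position below F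
    is maintained. *)
Lemma hull_pop F st h q : hull F st h.+1 -> (st h.+1 < q)%N -> above_chord F (st h.+1) q ->
  slope F (st h.+1) q <= slope F (st h) (st h.+1) ->
  [/\ hull F st h, (st h < q)%N & above_chord F (st h) q].
Proof.
move=> [H0 H1 H2 H3] hq aq sq; have h1 := H1 h (ltnSn h).
split; last by apply: above_trans sq (H2 h _) aq.
  by split=> // b bh; [apply: H1|apply: H2|apply: H3]; exact: ltnW.
exact: ltn_trans hq.
Qed.

Lemma hull_push F st st' h q : hull F st h -> (st h < q)%N -> above_chord F (st h) q ->
  (forall p, h = p.+1 -> slope F (st p) (st h) <= slope F (st h) q) ->
  (forall b, (b <= h)%N -> st' b = st b) -> st' h.+1 = q -> hull F st' h.+1.
Proof.
move=> [H0 H1 H2 H3] hq aq sq E Eq; split.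
- by rewrite E.
- move=> b; rewrite ltnS leq_eqVlt => /predU1P[->|bh]; first by rewrite Eq E.
  by rewrite !E ?H1 // ltnW.
- move=> b; rewrite ltnS leq_eqVlt => /predU1P[->|bh]; first by rewrite Eq E.
  by rewrite !E ?(ltnW bh) //; apply: H2.
- move=> b; rewrite ltnS leq_eqVlt => /predU1P[bh|bh].
    by rewrite bh Eq !E -?bh //; rewrite bh; apply: sq.
  by rewrite !E ?H3 // ltnW // ltnW.
Qed.

(** The hull edge over [t, t + 1]. Moving on by at most one edge per step suffices because vertices
    increase strictly, and is what [body_proj2] does. *)
Fixpoint hull_block (st : nat -> nat) t : nat :=
  if t is t'.+1 then
    let b := hull_block st t' in if (st b.+1 <= t)%N then b.+1 else b
  else 0.

Definition hull_fit F st t :=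
  slope F (st (hull_block st t)) (st (hull_block st t).+1).

Lemma hull_blockP F st h N t : hull F st h -> st h = N -> (t < N)%N ->
  (hull_block st t < h)%N /\
  (st (hull_block st t) <= t < st (hull_block st t).+1)%N.
Proof.
move=> [H0 H1 _ _] <-; elim: t => [|t IH] tN /=.
  case: h H1 tN => [|h] H1; first by rewrite H0.
  by move=> _; have := H1 0%N isT; rewrite H0.
have [] := IH (ltnW tN); set b := hull_block st t => bh /andP[l1 l2].
case: (leqP (st b.+1) t.+1) => l3; last by split=> //; rewrite l3 (leqW l1).
have e : st b.+1 = t.+1 by apply/eqP; rewrite eqn_leq l3.
have bh' : (b.+1 < h)%N.
  by rewrite ltn_neqAle bh andbT; apply: contraTneq tN => <-; rewrite e ltnn.
by split=> //; rewrite -{1}e leqnn -e H1.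
Qed.

(** The slopes sum up to the minorant itself. The partial sums of the residual are thus the gap
    between F and its minorant: nonnegative, and zero at the vertices, the only places where the
    slope can change. *)
Lemma hull_isotonic x F st h N : hull F st h -> st h = N ->
  (forall r, (r <= N)%N -> F r = \sum_(t < r) x t) ->
  isotonic N x (hull_fit F st).
Proof.
move=> Hh hN FE; have bP t := hull_blockP Hh hN (t := t).
have [H0 H1 H2 H3] := Hh.
pose f := hull_fit F st; pose bl := hull_block st.
have F0 : F 0%N = 0 by rewrite FE // big_ord0.
have fE r : (r < N)%N -> \sum_(t < r) f t = F (st (bl r)) + (r%:R - (st (bl r))%:R) * f r.
  elim: r => [|r IH] rN; first by rewrite /bl /= H0 F0 big_ord0 subrr mul0r addr0.
  rewrite big_ord_recr /= IH ?(ltnW rN) // /bl /f /hull_fit /=.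
  have [] := bP r (ltnW rN); set b := hull_block st r => bh /andP[l1 l2].
  case: leqP => l3; last by rewrite -natr1; ring.
  have e : st b.+1 = r.+1 by apply/eqP; rewrite eqn_leq l3.
  have lt := H1 b bh; rewrite e in lt *.
  by rewrite subrr mul0r addr0 [RHS](slopeE F lt) -natr1; ring.
(* At r + 1 the sum is still read off the edge of r; this includes the right end N, where no further
   edge starts. *)
have fS r : (r < N)%N -> \sum_(t < r.+1) f t = F (st (bl r)) + (r.+1%:R - (st (bl r))%:R) * f r.
  by move=> rN; rewrite big_ord_recr /= fE // -natr1; ring.
have S0 r : (r < N)%N -> \sum_(t < r.+1) f t <= F r.+1.
  move=> rN; rewrite fS //; have [bh /andP[l1 l2]] := bP r rN.
  by apply: (H2 _ bh); rewrite (leqW l1).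
have Sv r : (r < N)%N -> st (bl r).+1 = r.+1 -> \sum_(t < r.+1) f t = F r.+1.
  move=> rN e; rewrite fS //; have [bh _] := bP r rN.
  by rewrite -e [RHS](slopeE F (H1 _ bh)).
split.
- move=> t tN; rewrite /hull_fit /=.
  have [bh _] := bP t (ltnW tN); have [] := bP t.+1 tN => /=; case: ifP => // _ bh' _.
  exact: H3.
- move=> [|r] rN; first by rewrite big_ord0.
  by rewrite sumrB -FE // subr_ge0 S0.
- have [N0|N0] := posnP N; first by rewrite N0 big_ord0.
  have rN : (N.-1 < N)%N by rewrite prednK.
  have [bh /andP[l1 l2]] := bP _ rN; rewrite prednK // in l2.
  rewrite sumrB -FE //; have := Sv _ rN; rewrite prednK // => -> //.
    by rewrite subrr.
  apply/eqP; rewrite eqn_leq l2 andbT -{2}hN.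
  exact: (hull_mono Hh).
- move=> t tN; rewrite /hull_fit /=; case: leqP => l3; last by right.
  left; rewrite sumrB -FE ?(ltnW tN) // Sv ?(ltnW tN) ?subrr //.
  have [_ /andP[_ l2]] := bP t (ltnW tN).
  by apply/eqP; rewrite eqn_leq l3.
Qed.

End Isotonic.

(** * Merge passes *)

Section MergeSort.
Local Open Scope nat_scope.
Variable leT : rel nat.
Hypotheses (leT_total : total leT) (leT_trans : transitive leT).
Implicit Types A B : nat -> nat.

Definition slice A x y := [seq A t | t <- iota x (y - x)].

Lemma slice_nil A x y : y <= x -> slice A x y = [::].
Proof. by rewrite /slice -subn_eq0 => /eqP ->. Qed.

Lemma slice_cons A x y : x < y -> slice A x y = A x :: slice A x.+1 y.
Proof. by move=> xy; rewrite /slice -[y - x]prednK ?subn_gt0 //= subnS. Qed.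

Lemma slice_cat A x y z : x <= y <= z -> slice A x z = slice A x y ++ slice A y z.
Proof.
move=> /andP[xy yz]; rewrite /slice -map_cat -{2}(subnKC xy) -iotaD.
by congr map; congr iota; lia.
Qed.

Lemma slice_rcons A x y : x <= y -> slice A x y.+1 = rcons (slice A x y) (A y).
Proof.
move=> xy; rewrite (@slice_cat A x y) ?xy ?leqnSn //.
by rewrite (slice_cons A (ltnSn y)) (slice_nil A (leqnn _)) cats1.
Qed.

Lemma eq_slice A B x y : (forall t, x <= t < y -> A t = B t) -> slice A x y = slice B x y.
Proof. by move=> H; apply/eq_in_map => t; rewrite mem_iota => ?; apply: H; lia. Qed.

Lemma slice_sortedP A x y :
  reflect (forall t u, x <= t <= u -> u < y -> leT (A t) (A u)) (sorted leT (slice A x y)).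
Proof.
rewrite sorted_map; apply: (iffP idP) => [H t u tu uy|H].
  have srt : transitive (relpre A leT) by move=> ? ? ?; exact: leT_trans.
  have := sorted_leq_nth srt _ 0 H; move=> /(_ _)/= K.
  have refl : reflexive (relpre A leT) by move=> z /=; have := leT_total (A z) (A z); rewrite orbb.
  have := K refl (t - x) (u - x); rewrite !inE size_iota => /(_ _ _ _).
  rewrite !nth_iota; try lia.
  by rewrite !subnKC; try lia; apply; lia.
apply/(sortedP 0) => i; rewrite size_iota => iy.
by rewrite !nth_iota; try lia; apply: H; lia.
Qed.

Definition blocks_sorted v A L :=
  forall x y, x <= y -> y < L -> x %/ v = y %/ v -> leT (A x) (A y).

(* The slices [lo, mid) and [mid, e) of A are being merged into [lo, e) of B;
   i and j are the reading positions and o is the writing position. *)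
Record merging A B w N lo i mid j e o : Prop := Merging {
  mg_bounds : [/\ lo <= i, i <= mid, mid <= j, j <= e & e <= N];
  mg_out : o + mid = i + j;
  mg_lo : w.*2 %| lo;
  mg_e : (e < N -> w.*2 %| e) /\ e <= lo + w.*2;
  mg_sorted : sorted leT (slice A lo mid) /\ sorted leT (slice A mid e);
  mg_perm : perm_eq (slice B 0 lo) (slice A 0 lo);
  mg_blocks : blocks_sorted w.*2 B lo;
  mg_merge : slice B lo o ++ merge leT (slice A i mid) (slice A j e) =
             merge leT (slice A lo mid) (slice A mid e) }.

(** An empty, already completed merge: the first iteration then begins with a reset and needs no
    special case. *)
Lemma merging_init A B w N : merging A B w N 0 0 0 0 0 0.
Proof. by split=> //; rewrite dvdn0. Qed.

Lemma merging_end A B w N lo i mid j e : merging A B w N lo i mid j e e ->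
  0 < w -> perm_eq (slice B 0 e) (slice A 0 e) /\ blocks_sorted w.*2 B e.
Proof.
move=> [[b1 b2 b3 b4 b5] out]; have [loe im je lme] :
  [/\ lo <= e, i = mid, j = e & lo <= mid <= e] by split; lia.
move=> dlo _ [s1 s2] pm bs mg _; rewrite {}im {}je in mg.
rewrite !(slice_nil A (leqnn _)) cats0 in mg.
have pe : perm_eq (slice B lo e) (slice A lo e).
  by rewrite mg perm_merge -slice_cat.
split.
  rewrite (@slice_cat B 0 lo) ?loe // (@slice_cat A 0 lo) ?loe //.
  exact: perm_cat.
have /slice_sortedP st : sorted leT (slice B lo e).
  by rewrite mg; apply: merge_sorted.
move=> x y xy ye dxy; have [xlo|lox] := ltnP x lo; last by apply: st; rewrite ?lox.
(* As [lo] is a multiple of the block width, an index below it never shares a block with one at or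
   above it. *)
apply: bs => //; rewrite ltnNge; apply: contraL xlo => loy; rewrite -leqNgt.
rewrite -(divnK dlo); apply: leq_trans (leq_trunc_div x w.*2).
by rewrite leq_mul2r dxy leq_div2r ?orbT.
Qed.

(** Truncation at N affects only the last pair of slices, after which no reset occurs; divisibility
    of e is therefore demanded only for e < N. *)
Lemma merging_reset A B w N lo i mid j e : merging A B w N lo i mid j e e ->
  0 < w -> e < N -> blocks_sorted w A N ->
  merging A B w N e e (minn (e + w) N) (minn (e + w) N) (minn (e + w.*2) N) e.
Proof.
move=> mg w0 eN bA; have [pe be] := merging_end mg w0; case: mg => _ _ _ [/(_ eN) de _] _ _ _ _.
have dw : w %| e by apply: dvdn_trans de; rewrite -muln2 dvdn_mulr.
have blk c z : w %| c -> c <= z < c + w -> z %/ w = c %/ w.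
  move=> /dvdnP[q ->] zb; rewrite mulnK //; apply/eqP; rewrite eqn_leq.
  by rewrite leq_divRL // -ltnS ltn_divLR // mulSn; lia.
have ss c z : w %| c -> z <= c + w -> z <= N -> sorted leT (slice A c z).
  move=> dc zc zN; apply/slice_sortedP => t u tu uz; apply: bA; try lia.
  by rewrite !(blk c) //; lia.
split=> //.
- split; lia.
- split; last lia.
  move=> lN; rewrite (_ : minn _ _ = e + w.*2); last lia.
  by rewrite dvdn_addl.
- split; first by apply: ss; lia.
  have [l1|l1] := leqP (e + w) N; last by rewrite slice_nil //; lia.
  by apply: ss; rewrite ?dvdn_add ?dvdnn //; lia.
- by rewrite slice_nil.
Qed.

(** By [mg_merge], what is written followed by the merge of what remains is the final result, so
    emitting an entry is one unfolding of [merge]. *)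
Lemma merging_left A B B' w N lo i mid j e o : merging A B w N lo i mid j e o ->
  i < mid -> (j < e -> leT (A i) (A j)) ->
  (forall t, t < o -> B' t = B t) -> B' o = A i ->
  merging A B' w N lo i.+1 mid j e o.+1.
Proof.
move=> [[b1 b2 b3 b4 b5] out]; have [loo b6] : lo <= o /\ lo <= o.+1 by lia.
move=> dlo de ss pm bs mg im le EB Eo.
split=> //.
- by split=> //; lia.
- by clear -out; lia.
- by rewrite (@eq_slice B' B) // => t ?; apply: EB; lia.
- move=> x y xy ylo dxy; have yo := leq_trans ylo loo.
  by rewrite !EB ?(leq_ltn_trans xy yo) //; exact: bs.
rewrite -mg slice_rcons //.
rewrite Eo cat_rcons (@eq_slice B' B) => [|t ?]; last by apply: EB; lia.
congr cat; rewrite (slice_cons A im).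
have [je|ej] := ltnP j e; last by rewrite (slice_nil A ej); case: (slice A i.+1 mid).
by rewrite (slice_cons A je) /= le.
Qed.

Lemma merging_right A B B' w N lo i mid j e o : merging A B w N lo i mid j e o ->
  j < e -> (i < mid -> ~~ leT (A i) (A j)) ->
  (forall t, t < o -> B' t = B t) -> B' o = A j ->
  merging A B' w N lo i mid j.+1 e o.+1.
Proof.
move=> [[b1 b2 b3 b4 b5] out]; have [loo b6] : lo <= o /\ lo <= o.+1 by lia.
move=> dlo de ss pm bs mg je le EB Eo.
split=> //.
- by split=> //; lia.
- by clear -out; lia.
- by rewrite (@eq_slice B' B) // => t ?; apply: EB; lia.
- move=> x y xy ylo dxy; have yo := leq_trans ylo loo.
  by rewrite !EB ?(leq_ltn_trans xy yo) //; exact: bs.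
rewrite -mg slice_rcons //.
rewrite Eo cat_rcons (@eq_slice B' B) => [|t ?]; last by apply: EB; lia.
congr cat; rewrite (slice_cons A je).
have [im|mi] := ltnP i mid; last by rewrite (slice_nil A mi).
by rewrite (slice_cons A im) /= (negPf (le im)).
Qed.

Lemma merging_progress A B w N lo i mid j e o : merging A B w N lo i mid j e o ->
  o <= e /\ (o < e -> mid <= i -> j < e).
Proof. by move=> [[b1 b2 b3 b4 b5] out _ _ _ _ _ _]; split; lia. Qed.

End MergeSort.

(** * Row-major addressing and the projection onto C2 *)

Section Linearization.
Variable R : realType.

Lemma lin_lt m n (i : 'I_m) (j : 'I_n) : (i * n + j < m * n)%N.
Proof.
have := ltn_ord j; have : (i.+1 * n <= m * n)%N by rewrite leq_mul2r ltn_ord orbT.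
by rewrite mulSn; lia.
Qed.

Lemma lin_split m n q : (q < m * n)%N -> exists (i : 'I_m) (j : 'I_n), q = (i * n + j)%N.
Proof.
move=> qN; have n0 : (0 < n)%N by case: n qN => //; rewrite muln0.
have im : (q %/ n < m)%N by rewrite ltn_divLR.
by exists (Ordinal im), (Ordinal (ltn_pmod q n0)); exact: divn_eq.
Qed.

Lemma lin_inj m n (i i' : 'I_m) (j j' : 'I_n) :
  (i * n + j = i' * n + j')%N -> (i, j) = (i', j').
Proof.
move=> e; have n0 : (0 < n)%N by apply: leq_ltn_trans (ltn_ord j).
congr pair; apply: val_inj => /=.
  by have := congr1 (divn^~ n) e; rewrite /= !divnMDl // !divn_small // !addn0.
by have := congr1 (modn^~ n) e; rewrite /= !modnMDl !modn_small.
Qed.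

Definition unlin m n (W : 'M[R]_(m, n)) q : R :=
  if insub (q %/ n)%N is Some i then if insub (q %% n)%N is Some j then W i j else 0
  else 0.

Lemma unlinE m n (W : 'M[R]_(m, n)) (i : 'I_m) (j : 'I_n) : unlin W (i * n + j) = W i j.
Proof.
have n0 : (0 < n)%N by apply: leq_ltn_trans (ltn_ord j).
rewrite /unlin divnMDl // divn_small // addn0 modnMDl modn_small //.
by rewrite !valK.
Qed.

Lemma sum_lin m n (G : nat -> R) :
  \sum_(i < m) \sum_(j < n) G (i * n + j)%N = \sum_(q < m * n) G q.
Proof.
rewrite -(big_mkord xpredT G) big_nat_mul big_mkord; apply: eq_bigr => i _.
rewrite mulSn -{2}[(i * n)%N]add0n big_addn addnK big_mkord.
by apply: eq_bigr => j _; rewrite addnC.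
Qed.

Lemma sum_row m n (G : nat -> R) (i : 'I_m) :
  \sum_(q < m * n | (q %/ n)%N == i) G q = \sum_(j < n) G (i * n + j)%N.
Proof.
rewrite big_mkcond -(sum_lin m n (fun q => if (q %/ n)%N == i then G q else 0)).
have dv (i' : 'I_m) (j : 'I_n) : ((i' * n + j) %/ n)%N = i'.
  by rewrite divnMDl ?divn_small ?addn0 //; apply: leq_ltn_trans (ltn_ord j).
rewrite (bigD1 i) //= [X in _ + X]big1 ?addr0 => [|i' ne].
  by apply: eq_bigr => j _; rewrite dv eqxx.
by apply: big1 => j _; rewrite dv (inj_eq val_inj) (negPf ne).
Qed.

Lemma sum_col m n (G : nat -> R) (j : 'I_n) :
  \sum_(q < m * n | (q %% n)%N == j) G q = \sum_(i < m) G (i * n + j)%N.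
Proof.
rewrite big_mkcond -(sum_lin m n (fun q => if (q %% n)%N == j then G q else 0)).
apply: eq_bigr => i _; rewrite (bigD1 j) //= modnMDl modn_small // eqxx.
rewrite big1 ?addr0 // => j' ne.
by rewrite modnMDl modn_small // (inj_eq val_inj) (negPf ne).
Qed.

Lemma sum_perm (A : nat -> nat) N (G : nat -> R) : perm_eq (slice A 0 N) (iota 0 N) ->
  \sum_(q < N) G q = \sum_(t < N) G (A t).
Proof.
move=> pA; rewrite -(big_mkord xpredT G) -(big_mkord xpredT (G \o A)).
by rewrite /index_iota subn0 -(perm_big _ pA) /slice subn0 big_map.
Qed.

Lemma perm_slice_surj (A : nat -> nat) N q : perm_eq (slice A 0 N) (iota 0 N) ->
  (q < N)%N -> exists2 t, (t < N)%N & A t = q.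
Proof.
move=> /perm_mem pA qN; have : q \in iota 0 N by rewrite mem_iota.
by rewrite -pA => /mapP[t]; rewrite mem_iota subn0 => tN ->; exists t.
Qed.

Lemma perm_slice_lt (A : nat -> nat) N t : perm_eq (slice A 0 N) (iota 0 N) ->
  (t < N)%N -> (A t < N)%N.
Proof.
move=> /perm_mem pA tN; have := pA (A t).
by rewrite mem_iota /= => <-; apply: map_f; rewrite mem_iota subn0.
Qed.

Lemma perm_slice_inj (A : nat -> nat) N t u : perm_eq (slice A 0 N) (iota 0 N) ->
  (t < N)%N -> (u < N)%N -> A t = A u -> t = u.
Proof.
move=> /perm_uniq; rewrite iota_uniq /slice subn0 => un tN uN AE.
have e x : (x < N)%N -> nth 0%N [seq A t | t <- iota 0 N] x = A x.
  by move=> xN; rewrite (nth_map 0%N) ?size_iota // nth_iota.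
by apply/eqP; rewrite -(nth_uniq 0%N _ _ un) ?size_map ?size_iota // !e // AE.
Qed.

(** Lexicographic order by rank, then value. The nested negations mirror [blexle], as [bexp] has no
    disjunction, so that the program's test folds to this relation. *)
Definition lexle (rk : nat -> nat) (y : nat -> R) : rel nat :=
  fun p q => (rk p <= rk q)%N && ~~ ((rk q <= rk p)%N && ~~ (y p <= y q)).

Lemma lexle_total rk y : total (lexle rk y).
Proof.
move=> p q; rewrite /lexle; case: (ltngtP (rk p) (rk q)) => //= _.
by rewrite !negbK le_total.
Qed.

Lemma lexle_trans rk y : transitive (lexle rk y).
Proof.
move=> q p r; rewrite /lexle.
case: (ltngtP (rk p) (rk q)); case: (ltngtP (rk q) (rk r)) => //=;
  case: (ltngtP (rk p) (rk r)) => //=; rewrite ?negbK; try lia.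
by move=> _ _ _; exact: le_trans.
Qed.

Section ProjC2.
Variables (m n k : nat) (idx : 'I_k -> 'I_m * 'I_n).
Let N := (m * n)%N.
Let addr l := ((idx l).1 * n + (idx l).2)%N.

Variables (rk A : nat -> nat) (y f z : nat -> R).
Hypothesis rk_addr : forall l, rk (addr l) = l.+1.
Hypothesis rk_free : forall q, (q < N)%N -> rk q != 0%N -> exists l, q = addr l.
Hypothesis permA : perm_eq (slice A 0 N) (iota 0 N).
Hypothesis sortA : forall t u, (t <= u < N)%N -> lexle rk y (A t) (A u).
Hypothesis isof : isotonic N (y \o A) f.
Hypothesis zE : forall t, (t < N)%N -> z (A t) = Num.max (f t) 0.

(** Feasibility: a strictly smaller rank means an earlier position in A, along which the clipped f
    is nondecreasing. Optimality: any W in C2, read along A, is a g for [isotonic_clip_le0], with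
    the rank 0 positions as [fr]. *)
Lemma Proj_C2 (Y : 'M[R]_(m, n)) : (forall (i : 'I_m) (j : 'I_n), y (i * n + j)%N = Y i j) ->
  Proj (C2 idx) Y = \matrix_(i, j) z (i * n + j)%N.
Proof.
move=> yE; have fmono := mono_nat (iso_mono isof).
have zmono t u : (t < N)%N -> (u < N)%N -> (rk (A t) < rk (A u))%N -> z (A t) <= z (A u).
  move=> tN uN rtu; have tu : (t <= u)%N.
    rewrite leqNgt; apply/negP => ut; have := @sortA u t.
    by rewrite ltnW ?tN // => /(_ isT)/andP[]; lia.
  rewrite !zE // ge_max; apply/andP; split; last by rewrite le_max lexx orbT.
  by rewrite le_max fmono.
have zmono' p q : (p < N)%N -> (q < N)%N -> (rk p < rk q)%N -> z p <= z q.
  move=> /(perm_slice_surj permA)[t tN <-] /(perm_slice_surj permA)[u uN <-].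
  exact: zmono.
have aN l : (addr l < N)%N by exact: lin_lt.
have rk0 (i : 'I_m) (j : 'I_n) : (i, j) \in free_pairs idx <-> rk (i * n + j)%N = 0%N.
  rewrite /free_pairs inE; split=> [nf|r0].
    apply/eqP; apply: contraNT nf => /(rk_free (lin_lt i j))[l e].
    apply/imsetP; exists l => //; rewrite [RHS]surjective_pairing.
    exact: lin_inj e.
  apply/imsetP => -[l _ e]; have := rk_addr l.
  by rewrite /addr -e r0.
apply: Proj_eq.
  split.
  - move=> p q; rewrite mxE; have [t tN <-] := perm_slice_surj permA (lin_lt p q).
    by rewrite zE // le_max lexx orbT.
  - by move=> l l' ll'; rewrite !mxE; apply: zmono'; rewrite ?aN // !rk_addr ll'.
  - move=> l l0 p q /rk0 r0; rewrite !mxE; apply: zmono'; rewrite ?aN ?lin_lt //.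
    by rewrite r0 rk_addr.
move=> W [W0 Wc Wf].
have Wmono (l l' : 'I_k) : (l <= l')%N -> W (idx l).1 (idx l).2 <= W (idx l').1 (idx l').2.
  move=> ll'; have [d] : exists d, l' = (l + d)%N :> nat by exists (l' - l)%N; rewrite subnKC.
  elim: d l' {ll'} => [|d IH] l' e.
    by have -> : l' = l by apply: val_inj; rewrite /= e addn0.
  have dk : (l + d < k)%N by have := ltn_ord l'; rewrite e addnS; exact: ltnW.
  by apply: le_trans (IH (Ordinal dk) erefl) (Wc _ _ _); rewrite e addnS.
pose g t := unlin W (A t).
have gl t : (t < N)%N -> rk (A t) != 0%N ->
    exists l, g t = W (idx l).1 (idx l).2 /\ rk (A t) = l.+1.
  move=> tN /(rk_free (perm_slice_lt permA tN))[l e].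
  by exists l; rewrite /g e rk_addr /addr unlinE.
have g0 t : (t < N)%N -> 0 <= g t.
  move=> tN; have [i [j e]] := lin_split (perm_slice_lt permA tN).
  by rewrite /g e unlinE.
(* A level separating free from ranked values, namely the first ranked value. For k = 0 any upper
   bound of the nonnegative g will do, such as their sum. *)
have [c [c1 c2]] : exists c, (forall t, (t < N)%N -> rk (A t) == 0%N -> g t <= c) /\
    (forall t, (t < N)%N -> rk (A t) != 0%N -> c <= g t).
  case: (posnP k) => [k0|k0].
    exists (\sum_(t < N) g t); split=> t tN.
      move=> _; rewrite (bigD1 (Ordinal tN)) //= lerDl sumr_ge0 // => u _.
      exact: g0.
    by move=> /(gl t tN)[l _]; have := ltn_ord l; rewrite {2}k0.
  pose l0 := Ordinal k0; exists (W (idx l0).1 (idx l0).2); split=> t tN rt.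
    have [i [j e]] := lin_split (perm_slice_lt permA tN).
    rewrite /g e unlinE; apply: Wf => //; apply/rk0.
    by rewrite -e; apply/eqP.
  by have [l [-> _]] := gl t tN rt; apply: Wmono.
pose fr t := rk (A t) == 0%N; pose g' t := if fr t then c else g t.
have sortS t : (t.+1 < N)%N -> lexle rk y (A t) (A t.+1) by move=> tN; apply: sortA; lia.
rewrite (eq_bigr (fun i : 'I_m => \sum_(j < n) ((y (i * n + j)%N - z (i * n + j)%N) *
    (unlin W (i * n + j)%N - z (i * n + j)%N)))); last first.
  by move=> i _; apply: eq_bigr => j _; rewrite !mxE yE unlinE.
rewrite (sum_lin m n (fun q => (y q - z q) * (unlin W q - z q))).
rewrite -/N (sum_perm (fun q => (y q - z q) * (unlin W q - z q)) permA).
rewrite (eq_bigr (fun t : 'I_N =>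
  ((y \o A) t - Num.max (f t) 0) * (g t - Num.max (f t) 0))); last first.
  by move=> t _; rewrite zE.
apply: (isotonic_clip_le0 (g' := g') (fr := fr) isof); rewrite /fr /g' //.
- move=> t tN /eqP r0; have /andP[r1 r2] := sortS _ tN.
  by move: r1 r2; rewrite r0 leqn0 => /eqP ->; rewrite /= negbK.
- move=> t tN; have /andP[r1 _] := sortS _ tN.
  rewrite /fr; case: ifP => r0; case: ifP => r0' //.
  + by apply: c2; rewrite ?r0'.
  + by move: r1; rewrite (eqP r0') leqn0 r0.
  have [l [-> e]] := gl t (ltnW tN) (negbT r0).
  have [l' [-> e']] := gl t.+1 tN (negbT r0').
  by apply: Wmono; move: r1; rewrite e e'.
- by move=> t tN r0; rewrite /fr r0; apply: c1.
- by move=> t tN r0; rewrite /fr (negPf r0).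
Qed.

End ProjC2.
End Linearization.

(** * The program *)

Declare Scope cmd_scope.
Delimit Scope cmd_scope with cmd.
Notation "c1 ;; c2" := (Seq c1 c2) (at level 90, right associativity) : cmd_scope.

Definition nincr x := NSet x (NAdd (NVar x) (NConst 1)).
Definition nlt e1 e2 := BNot (BNle e2 e1).

Ltac simp := rewrite /= /upd_arr /upd /=.

(* Memory layout beyond the input and output registers.
   Naturals: 3 = N = mn; 4 = loop counter or position; 5, 6 = row and column of
   entry 4 (merge: reading positions; hull: 5 = index of the current vertex);
   7, 8 = ends of the two slices being merged; 9 = their width.
   Natural arrays: 2 = row offsets; 3 = rank of an entry, 0 on the free pairs;
   4 = the ordering of the entries; 5 = merge buffer; 6 = vertices of the hull.
   Reals: 1 = m; 2 = n; 3 = 1 minus the sum of the entries; 4 = temporary.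
   Real arrays: 0, 1 = a, b, overwritten by the row and column residuals;
   5 = Y, then X'; 8 = X' + M; 9 = partial sums; 10 = 0, 1, ..., N as reals,
   since naturals cannot be converted. *)
Definition init_dims : cmd :=
  (NSet 3 (NConst 0);; NSet 4 (NConst 0);; RSet 1 RZero)%cmd.
Definition body_dims : cmd :=
  (NPut 2 (NVar 4) (NVar 3);; NSet 3 (NAdd (NVar 3) (NVar 1));;
   RSet 1 (RAdd (RVar 1) ROne);; nincr 4)%cmd.
Definition prog_dims : cmd := (init_dims;; While (nlt (NVar 4) (NVar 0)) body_dims)%cmd.

Definition init_width : cmd := (NSet 4 (NConst 0);; RSet 2 RZero)%cmd.
Definition body_width : cmd := (RSet 2 (RAdd (RVar 2) ROne);; nincr 4)%cmd.
Definition prog_width : cmd := (init_width;; While (nlt (NVar 4) (NVar 1)) body_width)%cmd.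

(** Replaces division: the column counter wraps at n and then advances the row. *)
Definition next_entry : cmd :=
  (nincr 4;; nincr 6;;
   If (BNle (NVar 1) (NVar 6)) (NSet 6 (NConst 0);; nincr 5) Skip)%cmd.

Definition init_residuals : cmd :=
  (NSet 4 (NConst 0);; NSet 5 (NConst 0);; NSet 6 (NConst 0);; RSet 3 ROne)%cmd.
Definition body_residuals : cmd :=
  (RSet 4 (RSub (RSub (RGet 3 (NVar 4)) (RGet 4 (NVar 4)))
                (RDiv (RGet 2 (NVar 4)) (RVar 0)));;
   RPut 5 (NVar 4) (RVar 4);;
   RPut 0 (NVar 5) (RSub (RGet 0 (NVar 5)) (RVar 4));;
   RPut 1 (NVar 6) (RSub (RGet 1 (NVar 6)) (RVar 4));;
   RSet 3 (RSub (RVar 3) (RVar 4));; next_entry)%cmd.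
Definition prog_residuals : cmd :=
  (init_residuals;; While (nlt (NVar 4) (NVar 3)) body_residuals)%cmd.

Definition init_proj1 : cmd :=
  (NSet 4 (NConst 0);; NSet 5 (NConst 0);; NSet 6 (NConst 0))%cmd.
Definition body_proj1 : cmd :=
  (RPut 5 (NVar 4)
     (RSub (RAdd (RAdd (RGet 5 (NVar 4)) (RDiv (RGet 0 (NVar 5)) (RVar 2)))
                 (RDiv (RGet 1 (NVar 6)) (RVar 1)))
           (RDiv (RVar 3) (RMul (RVar 2) (RVar 1))));;
   RPut 8 (NVar 4) (RAdd (RGet 5 (NVar 4)) (RGet 4 (NVar 4)));;
   NPut 3 (NVar 4) (NConst 0);; NPut 4 (NVar 4) (NVar 4);; next_entry)%cmd.
Definition prog_proj1 : cmd :=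
  (init_proj1;; While (nlt (NVar 4) (NVar 3)) body_proj1)%cmd.

Definition body_ranks : cmd :=
  (NPut 3 (NAdd (NGet 2 (NGet 0 (NVar 4))) (NGet 1 (NVar 4)))
     (NAdd (NVar 4) (NConst 1));; nincr 4)%cmd.
Definition prog_ranks : cmd :=
  (NSet 4 (NConst 0);; While (nlt (NVar 4) (NVar 2)) body_ranks)%cmd.

Definition blexle e1 e2 : bexp :=
  BAnd (BNle (NGet 3 e1) (NGet 3 e2))
    (BNot (BAnd (BNle (NGet 3 e2) (NGet 3 e1)) (BNot (BRle (RGet 8 e1) (RGet 8 e2))))).
(** The minimum, thanks to truncated subtraction. *)
Definition nmin e1 e2 := NSub e1 (NSub e1 e2).

Definition init_merge : cmd :=
  (NSet 4 (NConst 0);; NSet 5 (NConst 0);; NSet 6 (NConst 0);; NSet 7 (NConst 0);;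
   NSet 8 (NConst 0))%cmd.
(* Each iteration of a merge pass outputs exactly one entry, moving on to the
   next two slices first if necessary: a single loop then has a linear cost. *)
Definition merge_reset : cmd :=
  If (BNle (NVar 8) (NVar 4))
    (NSet 5 (NVar 4);; NSet 7 (nmin (NAdd (NVar 4) (NVar 9)) (NVar 3));;
     NSet 6 (NVar 7);;
     NSet 8 (nmin (NAdd (NVar 4) (NAdd (NVar 9) (NVar 9))) (NVar 3)))%cmd
    Skip.
Definition merge_emit : cmd :=
  If (BAnd (nlt (NVar 5) (NVar 7))
       (BNot (BAnd (nlt (NVar 6) (NVar 8))
                   (BNot (blexle (NGet 4 (NVar 5)) (NGet 4 (NVar 6)))))))
    (NPut 5 (NVar 4) (NGet 4 (NVar 5));; nincr 5;; nincr 4)%cmd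
    (NPut 5 (NVar 4) (NGet 4 (NVar 6));; nincr 6;; nincr 4)%cmd.
Definition body_merge : cmd := (merge_reset;; merge_emit)%cmd.
Definition prog_merge : cmd :=
  (init_merge;; While (nlt (NVar 4) (NVar 3)) body_merge)%cmd.

Definition body_copy : cmd := (NPut 4 (NVar 4) (NGet 5 (NVar 4));; nincr 4)%cmd.
Definition prog_copy : cmd :=
  (NSet 4 (NConst 0);; While (nlt (NVar 4) (NVar 3)) body_copy)%cmd.

Definition body_sort : cmd := (prog_merge;; prog_copy;; NSet 9 (NAdd (NVar 9) (NVar 9)))%cmd.
Definition prog_sort : cmd :=
  (NSet 9 (NConst 1);; While (nlt (NVar 9) (NVar 3)) body_sort)%cmd.

Definition init_sums : cmd :=
  (NSet 4 (NConst 0);; RPut 9 (NConst 0) RZero;; RPut 10 (NConst 0) RZero)%cmd.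
Definition body_sums : cmd :=
  (RPut 9 (NAdd (NVar 4) (NConst 1))
     (RAdd (RGet 9 (NVar 4)) (RGet 8 (NGet 4 (NVar 4))));;
   RPut 10 (NAdd (NVar 4) (NConst 1)) (RAdd (RGet 10 (NVar 4)) ROne);; nincr 4)%cmd.
Definition prog_sums : cmd :=
  (init_sums;; While (nlt (NVar 4) (NVar 3)) body_sums)%cmd.

Definition rslope e1 e2 :=
  RDiv (RSub (RGet 9 e2) (RGet 9 e1)) (RSub (RGet 10 e2) (RGet 10 e1)).

Definition init_hull : cmd :=
  (NSet 5 (NConst 0);; NPut 6 (NConst 0) (NConst 0);; NSet 4 (NConst 1))%cmd.
(** Each iteration either pops one vertex or pushes one point; an inner loop for the pops would
    require amortized cost accounting. *)
Definition body_hull : cmd :=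
  If (BAnd (BNle (NConst 1) (NVar 5))
       (BRle (rslope (NGet 6 (NVar 5)) (NVar 4))
             (rslope (NGet 6 (NSub (NVar 5) (NConst 1))) (NGet 6 (NVar 5)))))
    (NSet 5 (NSub (NVar 5) (NConst 1)))
    (nincr 5;; NPut 6 (NVar 5) (NVar 4);; nincr 4)%cmd.
Definition prog_hull : cmd := (init_hull;; While (BNle (NVar 4) (NVar 3)) body_hull)%cmd.

Definition init_proj2 : cmd := (NSet 4 (NConst 0);; NSet 5 (NConst 0))%cmd.
Definition body_proj2 : cmd :=
  (RSet 4 (rslope (NGet 6 (NVar 5)) (NGet 6 (NAdd (NVar 5) (NConst 1))));;
   If (BRle RZero (RVar 4)) (RPut 6 (NGet 4 (NVar 4)) (RVar 4))
     (RPut 6 (NGet 4 (NVar 4)) RZero);;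
   nincr 4;;
   If (BNle (NGet 6 (NAdd (NVar 5) (NConst 1))) (NVar 4)) (nincr 5) Skip)%cmd.
Definition prog_proj2 : cmd :=
  (init_proj2;; While (nlt (NVar 4) (NVar 3)) body_proj2)%cmd.

Definition body_dual : cmd :=
  (RPut 7 (NVar 4) (RSub (RAdd (RGet 4 (NVar 4)) (RGet 5 (NVar 4))) (RGet 6 (NVar 4)));;
   nincr 4)%cmd.
Definition prog_dual : cmd :=
  (NSet 4 (NConst 0);; While (nlt (NVar 4) (NVar 3)) body_dual)%cmd.

(** Turns the wrap test of [next_entry] into the divisibility that governs [divnS] and [modnS]. *)
Lemma dvdn_succE n p : (0 < n)%N -> (n %| p.+1)%N = (n <= (p %% n).+1)%N.
Proof.
move=> n0; rewrite /dvdn -addn1 -modnDml addn1.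
have := ltn_pmod p n0; rewrite leq_eqVlt => /predU1P[->|lt].
  by rewrite modnn leqnn.
by rewrite modn_small // leqNgt lt.
Qed.

(** * Correctness and running time of the linear phases *)

Section Phases.
Variable R : realType.
Implicit Types s : state R.

Lemma reach_dims s : reach prog_dims s
  (for_cost init_dims (nlt (NVar 4) (NVar 0)) body_dims (nvar s 0))
  (fun s' => [/\ nvar s' 3 = (nvar s 0 * nvar s 1)%N, rvar s' 1 = (nvar s 0)%:R
     & forall i, (i < nvar s 0)%N -> narr s' 2 i = (i * nvar s 1)%N]).
Proof.
apply: (reach_for_init (I := fun d s' => [/\ (nvar s' 4 + d = nvar s 0)%N,
   nvar s' 3 = (nvar s' 4 * nvar s 1)%N, rvar s' 1 = (nvar s' 4)%:R
  & forall i, (i < nvar s' 4)%N -> narr s' 2 i = (i * nvar s 1)%N])) => //.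
- move=> d s' sm [id i3 i1 i2] /=.
  have e0 := same_nvar sm (x := 0%N) isT; have e1 := same_nvar sm (x := 1%N) isT.
  rewrite e0 => lt; exists d.-1; first lia.
  simp; rewrite e1 i3 i1 natrD; split => //; [lia|by rewrite mulnDl mul1n|].
  move=> i; rewrite addn1 ltnS leq_eqVlt => /predU1P[->|li]; first by rewrite eqxx.
  by rewrite ltn_eqF // i2.
move=> d s' sm [id i3 i1 i2] /=; rewrite (same_nvar sm (x := 0%N) isT) => lt.
have e : nvar s' 4 = nvar s 0 by lia.
by rewrite -e i3 i1; split=> // i; apply: i2.
Qed.

Lemma reach_width s : reach prog_width s
  (for_cost init_width (nlt (NVar 4) (NVar 1)) body_width (nvar s 1))
  (fun s' => rvar s' 2 = (nvar s 1)%:R).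
Proof.
apply: (reach_for_init (I := fun d s' => (nvar s' 4 + d = nvar s 1)%N /\
   rvar s' 2 = (nvar s' 4)%:R)) => //.
- move=> d s' sm [id i2] /=; rewrite (same_nvar sm (x := 1%N) isT) => lt.
  exists d.-1; first lia.
  by simp; rewrite i2 natrD; split => //; lia.
move=> d s' sm [id i2] /=; rewrite (same_nvar sm (x := 1%N) isT) => lt.
by rewrite i2; congr (_%:R); lia.
Qed.

(** Summing over positions with a given quotient or remainder lets the invariant treat complete and
    incomplete rows alike. *)
Lemma reach_residuals s : (0 < nvar s 1)%N ->
  let n := nvar s 1 in
  let y q := rarr s 3 q - rarr s 4 q - rarr s 2 q / rvar s 0 in
  reach prog_residuals s
  (for_cost init_residuals (nlt (NVar 4) (NVar 3)) body_residuals (nvar s 3))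
  (fun s' => [/\ forall q, (q < nvar s 3)%N -> rarr s' 5 q = y q,
    forall i, rarr s' 0 i = rarr s 0 i - \sum_(q < nvar s 3 | (q %/ n)%N == i) y q,
    forall j, rarr s' 1 j = rarr s 1 j - \sum_(q < nvar s 3 | (q %% n)%N == j) y q
    & rvar s' 3 = 1 - \sum_(q < nvar s 3) y q]).
Proof.
move=> n0 n y.
pose P (ra : nat -> nat -> R) v p := [/\ forall q, (q < p)%N -> ra 5 q = y q,
    forall i, ra 0 i = rarr s 0 i - \sum_(q < p | (q %/ n)%N == i) y q,
    forall j, ra 1 j = rarr s 1 j - \sum_(q < p | (q %% n)%N == j) y q
    & v = 1 - \sum_(q < p) y q].
have stepP ra v p : P ra v p ->
    P (upd_arr (upd_arr (upd_arr ra 5 p (y p)) 0 (p %/ n) (ra 0 (p %/ n)%N - y p))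
         1 (p %% n) (ra 1 (p %% n)%N - y p)) (v - y p) p.+1.
  move=> [j5 j0 j1 jv]; rewrite /P; simp; split.
  - by move=> q; rewrite ltnS leq_eqVlt; case: eqP => [->//|_] /= /j5.
  - move=> i; rewrite big_mkcond big_ord_recr -big_mkcond /= !j0 eq_sym.
    by case: eqP => [->|_]; ring.
  - move=> j; rewrite big_mkcond big_ord_recr -big_mkcond /= !j1 eq_sym.
    by case: eqP => [->|_]; ring.
  - by rewrite big_ord_recr jv /=; ring.
apply: (reach_for_init (I := fun d s' => [/\ (nvar s' 4 + d = nvar s 3)%N,
    nvar s' 5 = (nvar s' 4 %/ n)%N, nvar s' 6 = (nvar s' 4 %% n)%N
  & P (rarr s') (rvar s' 3) (nvar s' 4)])) => //.
- simp; split; rewrite ?div0n ?mod0n //.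
  by split=> // [i|j|]; rewrite big_ord0 subr0.
- move=> d s' sm [id i5 i6 /stepP pp] /=; rewrite (same_nvar sm (x := 3%N) isT) => lt.
  have e1 := same_nvar sm (x := 1%N) isT.
  have yE : rarr s' 3 (nvar s' 4) - rarr s' 4 (nvar s' 4) - rarr s' 2 (nvar s' 4) / rvar s' 0 =
      y (nvar s' 4).
    rewrite (same_rarr sm (r := 3%N) isT) (same_rarr sm (r := 4%N) isT).
    by rewrite (same_rarr sm (r := 2%N) isT) (same_rvar sm (x := 0%N) isT).
  exists d.-1; first lia.
  simp; rewrite yE e1 i5 i6 -/n !addn1 -dvdn_succE //.
  by case: ifP => dv; simp; rewrite ?i5 ?addn1 divnS // modnS dv; split=> //; lia.
move=> d s' sm [id i5 i6 pp] /=; rewrite (same_nvar sm (x := 3%N) isT) => lt.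
by have -> : nvar s 3 = nvar s' 4 by lia.
Qed.

Lemma reach_proj1 s : (0 < nvar s 1)%N ->
  let n := nvar s 1 in
  let x q := rarr s 5 q + rarr s 0 (q %/ n)%N / rvar s 2 + rarr s 1 (q %% n)%N / rvar s 1
    - rvar s 3 / (rvar s 2 * rvar s 1) in
  reach prog_proj1 s
  (for_cost init_proj1 (nlt (NVar 4) (NVar 3)) body_proj1 (nvar s 3))
  (fun s' => forall q, (q < nvar s 3)%N ->
    [/\ rarr s' 5 q = x q, rarr s' 8 q = x q + rarr s 4 q, narr s' 3 q = 0%N
      & narr s' 4 q = q]).
Proof.
move=> n0 n x.
(* X' overwrites Y in place, so the invariant also records that the cells not yet visited still hold
   Y. *)
pose P (ra : nat -> nat -> R) (na : nat -> nat -> nat) p :=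
  (forall q, (q < p)%N -> [/\ ra 5 q = x q, ra 8 q = x q + rarr s 4 q, na 3 q = 0%N
    & na 4 q = q]) /\ (forall q, (p <= q)%N -> ra 5 q = rarr s 5 q).
have stepP ra na p v w : P ra na p -> v = x p -> w = x p + rarr s 4 p ->
    P (upd_arr (upd_arr ra 5 p v) 8 p w) (upd_arr (upd_arr na 3 p 0%N) 4 p p) p.+1.
  move=> [j1 j2] -> ->; rewrite /P; simp; split=> q.
    by rewrite ltnS leq_eqVlt; case: eqP => [->//|_] /= /j1.
  by move=> pq; rewrite gtn_eqF // j2 // ltnW.
apply: (reach_for_init (I := fun d s' => [/\ (nvar s' 4 + d = nvar s 3)%N,
    nvar s' 5 = (nvar s' 4 %/ n)%N, nvar s' 6 = (nvar s' 4 %% n)%N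
  & P (rarr s') (narr s') (nvar s' 4)])) => //.
- by simp; split; rewrite ?div0n ?mod0n //; split.
- move=> d s' sm [id i5 i6 pp] /=; rewrite (same_nvar sm (x := 3%N) isT) => lt.
  have e1 := same_nvar sm (x := 1%N) isT.
  have xE : rarr s' 5 (nvar s' 4) + rarr s' 0 (nvar s' 5) / rvar s' 2 +
      rarr s' 1 (nvar s' 6) / rvar s' 1 - rvar s' 3 / (rvar s' 2 * rvar s' 1) = x (nvar s' 4).
    rewrite (same_rarr sm (r := 0%N) isT) (same_rarr sm (r := 1%N) isT).
    rewrite (same_rvar sm (x := 1%N) isT) (same_rvar sm (x := 2%N) isT).
    by rewrite (same_rvar sm (x := 3%N) isT) pp.2 // i5 i6.
  have {}pp := stepP _ _ _ _ _ pp xE (congr1 (fun v => v + rarr s 4 (nvar s' 4)) xE).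
  rewrite -(same_rarr sm (r := 4%N) isT) in pp.
  exists d.-1; first lia.
  simp; rewrite eqxx e1 i5 i6 -/n !addn1 -dvdn_succE //; rewrite i5 i6 in pp.
  by case: ifP => dv; simp; rewrite ?i5 ?addn1 divnS // modnS dv; split=> //; lia.
move=> d s' sm [id i5 i6 [pp _]] /=; rewrite (same_nvar sm (x := 3%N) isT) => lt.
by have -> : nvar s 3 = nvar s' 4 by lia.
Qed.

Lemma reach_ranks s :
  let addr l := (narr s 2 (narr s 0 l) + narr s 1 l)%N in
  (forall l l', (l < nvar s 2)%N -> (l' < nvar s 2)%N -> addr l = addr l' -> l = l') ->
  reach prog_ranks s
  (for_cost (NSet 4 (NConst 0)) (nlt (NVar 4) (NVar 2)) body_ranks (nvar s 2))
  (fun s' => (forall l, (l < nvar s 2)%N -> narr s' 3 (addr l) = l.+1) /\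
    (forall q, (exists2 l, (l < nvar s 2)%N & q = addr l) \/ narr s' 3 q = narr s 3 q)).
Proof.
move=> addr inj.
apply: (reach_for_init (I := fun d s' => [/\ (nvar s' 4 + d = nvar s 2)%N,
    forall l, (l < nvar s' 4)%N -> narr s' 3 (addr l) = l.+1 &
    forall q, (exists2 l, (l < nvar s 2)%N & q = addr l) \/ narr s' 3 q = narr s 3 q])) => //.
- by simp; split=> // q; right.
- move=> d s' sm [id i1 i2] /=; rewrite (same_nvar sm (x := 2%N) isT) => lt.
  exists d.-1; first lia.
  have adE : (narr s' 2 (narr s' 0 (nvar s' 4)) + narr s' 1 (nvar s' 4))%N = addr (nvar s' 4).
    rewrite (same_narr sm (r := 2%N) isT) (same_narr sm (r := 0%N) isT).
    by rewrite (same_narr sm (r := 1%N) isT).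
  simp; rewrite adE addn1; split; first lia.
  + move=> l; rewrite ltnS leq_eqVlt => /predU1P[->|ll]; first by rewrite eqxx.
    (* Distinct index pairs: no rank written earlier is overwritten. *)
    rewrite ifN ?i1 //; apply/eqP => /inj; lia.
  + by move=> q; case: eqP => [->|_]; [left; exists (nvar s' 4); lia|exact: i2].
move=> d s' sm [id i1 i2] /=; rewrite (same_nvar sm (x := 2%N) isT) => lt.
by split=> // l ll; apply: i1; lia.
Qed.

Lemma reach_copy s : reach prog_copy s
  (for_cost (NSet 4 (NConst 0)) (nlt (NVar 4) (NVar 3)) body_copy (nvar s 3))
  (fun s' => forall q, (q < nvar s 3)%N -> narr s' 4 q = narr s 5 q).
Proof.
apply: (reach_for_init (I := fun d s' => (nvar s' 4 + d = nvar s 3)%N /\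
    forall q, (q < nvar s' 4)%N -> narr s' 4 q = narr s 5 q)) => //.
- move=> d s' sm [id i1] /=; rewrite (same_nvar sm (x := 3%N) isT) => lt.
  exists d.-1; first lia.
  simp; rewrite (same_narr sm (r := 5%N) isT) addn1; split; first lia.
  move=> q; rewrite ltnS leq_eqVlt => /predU1P[->|ll]; first by rewrite eqxx.
  by rewrite ltn_eqF // i1.
move=> d s' sm [id i1] /=; rewrite (same_nvar sm (x := 3%N) isT) => lt q qN.
by apply: i1; lia.
Qed.

(** [lo] is a ghost value: the program does not store where the current pair of slices starts. *)
Definition merge_state s N w lo : Prop :=
  [/\ nvar s 3 = N, nvar s 9 = w & merging (lexle (narr s 3) (rarr s 8)) (narr s 4)
    (narr s 5) w N lo (nvar s 5) (nvar s 7) (nvar s 6) (nvar s 8) (nvar s 4)].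

Lemma run_merge_reset s N w lo : merge_state s N w lo -> (nvar s 4 < N)%N -> (0 < w)%N ->
  blocks_sorted (lexle (narr s 3) (rarr s 8)) w (narr s 4) N ->
  let s1 := run merge_reset s in
  [/\ exists lo1, merge_state s1 N w lo1, (nvar s1 4 < nvar s1 8)%N,
    nvar s1 4 = nvar s 4 & narr s1 = narr s /\ rarr s1 = rarr s].
Proof.
move=> [N3 w9 mg] lt w0 bA; have [le_oe _] := merging_progress mg.
rewrite /=; case: (leqP (nvar s 8) (nvar s 4)) => eo; last by split=> //; exists lo.
have oe : nvar s 4 = nvar s 8 by apply/eqP; rewrite eqn_leq le_oe.
simp; split=> //; last by rewrite w9 N3 -minnE leq_min lt andbT; lia.
exists (nvar s 4); split=> //; simp.
rewrite -oe in mg; rewrite w9 N3 -!minnE addnn.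
by apply: (merging_reset _ _ mg w0 lt bA); [exact: lexle_total|exact: lexle_trans].
Qed.

Lemma run_merge_emit s N w lo : merge_state s N w lo -> (nvar s 4 < nvar s 8)%N ->
  let s1 := run merge_emit s in
  merge_state s1 N w lo /\ nvar s1 4 = (nvar s 4).+1.
Proof.
move=> [N3 w9 mg] lt; have [_ pr] := merging_progress mg.
rewrite /= -/(lexle (narr s 3) (rarr s 8) _ _) -!ltnNge.
case: ifP => [/andP[im jl]|H]; rewrite /merge_state; simp; rewrite !addn1; split=> //;
  split=> //.
- apply: (merging_left mg im _ _ _); last by simp; rewrite eqxx.
    by move=> je; move: jl; rewrite je negbK.
  by move=> t to; simp; rewrite ltn_eqF.
- have je : (nvar s 6 < nvar s 8)%N.
    by have [mi|im] := leqP (nvar s 7) (nvar s 5); [exact: pr|];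
      move: H; rewrite im; case: ltnP.
  apply: (merging_right mg je _ _ _); last by simp; rewrite eqxx.
    by move=> im; move: H; rewrite im je /= negbK => ->.
  by move=> t to; simp; rewrite ltn_eqF.
Qed.

Lemma reach_merge s : (0 < nvar s 9)%N ->
  let leT := lexle (narr s 3) (rarr s 8) in
  blocks_sorted leT (nvar s 9) (narr s 4) (nvar s 3) ->
  reach prog_merge s
  (for_cost init_merge (nlt (NVar 4) (NVar 3)) body_merge (nvar s 3))
  (fun s' => perm_eq (slice (narr s' 5) 0 (nvar s 3)) (slice (narr s 4) 0 (nvar s 3)) /\
    blocks_sorted leT (nvar s 9).*2 (narr s' 5) (nvar s 3)).
Proof.
move=> w0 leT bA.
apply: (reach_for_init (I := fun d s' => (nvar s' 4 + d = nvar s 3)%N /\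
  exists lo, merge_state s' (nvar s 3) (nvar s 9) lo)) => //.
- by simp; split=> //; exists 0%N; split=> //; exact: merging_init.
- move=> d s' sm [id [lo mg]]; rewrite [beval _ _]/= (same_nvar sm (x := 3%N) isT) -ltnNge => lt.
  exists d.-1; first lia.
  rewrite [run _ _]/(run merge_emit (run merge_reset s')).
  have [|[lo1 mg1] lt1 E4 _] := run_merge_reset mg lt w0.
    rewrite (same_narr sm (r := 3%N) isT) (same_narr sm (r := 4%N) isT).
    by rewrite (same_rarr sm (r := 8%N) isT).
  have [mg2 ->] := run_merge_emit mg1 lt1.
  by rewrite E4; split; [lia|exists lo1].
move=> d s' sm [id [lo [_ _ mg]]].
rewrite [beval _ _]/= (same_nvar sm (x := 3%N) isT) -ltnNge -leqNgt => lt.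
have [le_oe _] := merging_progress mg; have [_ _ _ _ eN] := mg_bounds mg.
have oN : nvar s' 4 = nvar s 3 by lia.
have eE : nvar s' 8 = nvar s 3 by lia.
rewrite oN eE in mg.
rewrite (same_narr sm (r := 3%N) isT) (same_narr sm (r := 4%N) isT) in mg.
rewrite (same_rarr sm (r := 8%N) isT) in mg.
by apply: (merging_end _ _ mg w0); [exact: lexle_total|exact: lexle_trans].
Qed.

Lemma reach_sums s : reach prog_sums s
  (for_cost init_sums (nlt (NVar 4) (NVar 3)) body_sums (nvar s 3))
  (fun s' => forall r, (r <= nvar s 3)%N ->
    rarr s' 9 r = \sum_(t < r) rarr s 8 (narr s 4 t) /\ rarr s' 10 r = r%:R).
Proof.
apply: (reach_for_init (I := fun d s' => (nvar s' 4 + d = nvar s 3)%N /\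
    forall r, (r <= nvar s' 4)%N ->
    rarr s' 9 r = \sum_(t < r) rarr s 8 (narr s 4 t) /\ rarr s' 10 r = r%:R)) => //.
- by simp; split=> // r; rewrite leqn0 => /eqP ->; rewrite big_ord0.
- move=> d s' sm [id i1] /=; rewrite (same_nvar sm (x := 3%N) isT) => lt.
  exists d.-1; first lia.
  simp; rewrite (same_rarr sm (r := 8%N) isT) (same_narr sm (r := 4%N) isT) addn1.
  split; first lia.
  move=> r; rewrite leq_eqVlt ltnS => /predU1P[->|ll]; last by rewrite ltn_eqF //; exact: i1.
  have [-> ->] := i1 _ (leqnn (nvar s' 4)).
  by rewrite eqxx big_ord_recr natr1.
move=> d s' sm [id i1] /=; rewrite (same_nvar sm (x := 3%N) isT) => lt r rN.
by apply: i1; lia.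
Qed.

(** The variant is 2(N + 1 - q) + h, initially 2N: a pop lowers h by one, a push raises both q and h
    by one, so every iteration decreases it by one. *)
Lemma reach_hull s : (0 < nvar s 3)%N ->
  (forall r, (r <= nvar s 3)%N -> rarr s 10 r = r%:R) ->
  reach prog_hull s
  (for_cost init_hull (BNle (NVar 4) (NVar 3)) body_hull (2 * nvar s 3))
  (fun s' => exists h, hull (rarr s 9) (narr s' 6) h /\ narr s' 6 h = nvar s 3).
Proof.
move=> N0 s10; set F := rarr s 9; set N := nvar s 3.
apply: (reach_for_init (I := fun d s' => let h := nvar s' 5 in let q := nvar s' 4 in
  [/\ (2 * q + d = 2 * N + 2 + h)%N, hull F (narr s' 6) h, (narr s' 6 h < q <= N.+1)%N,
     above_chord F (narr s' 6 h) q & (q <= N)%N \/ narr s' 6 h = N])) => //.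
- simp; split=> //; first lia; last by left.
  exact: above_succ.
- move=> d s' sm; set h := nvar s' 5; set q := nvar s' 4 => -[id hu /andP[hq _] aq _].
  rewrite /= (same_nvar sm (x := 3%N) isT) -/q -/N => qN.
  have slE a b : (a <= N)%N -> (b <= N)%N ->
      (rarr s' 9 b - rarr s' 9 a) / (rarr s' 10 b - rarr s' 10 a) = slope F a b.
    move=> aN bN; rewrite (same_rarr sm (r := 9%N) isT) (same_rarr sm (r := 10%N) isT).
    by rewrite !s10.
  exists d.-1; first by case: (d) id => //; lia.
  have hN : (narr s' 6 h <= N)%N by apply: leq_trans qN; exact: ltnW.
  have push : (forall p, h = p.+1 ->
      slope F (narr s' 6 p) (narr s' 6 h) <= slope F (narr s' 6 h) q) ->
    let st := upd_arr (narr s') 6 h.+1 q 6%N in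
    [/\ (2 * q.+1 + d.-1 = 2 * N + 2 + h.+1)%N, hull F st h.+1, (st h.+1 < q.+1 <= N.+1)%N,
     above_chord F (st h.+1) q.+1 & (q.+1 <= N)%N \/ st h.+1 = N].
    move=> sl st; have stq : st h.+1 = q by rewrite /st; simp; rewrite eqxx.
    rewrite stq; split; [by case: (d) id => //; lia| |lia|exact: above_succ|lia].
    apply: hull_push hu hq aq sl _ stq => b bh.
    by rewrite /st; simp; rewrite ltn_eqF.
  simp; rewrite -/h -/q; case: ifP; last first.
    rewrite !addn1 => H; apply: push => p hp.
    have pN : (narr s' 6 p <= N)%N.
      by apply: leq_trans hN; rewrite hp ltnW // (hull_lt hu) // hp.
    move: H; rewrite hp /= subn1 /= -hp !slE // => /negbT; rewrite -ltNge.
    exact: ltW.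
  case: h id hu hq aq hN {push} => [|h] // id hu hq aq hN /andP[_]; rewrite subn1 /=.
  have pN : (narr s' 6 h <= N)%N by apply: leq_trans hN; rewrite ltnW // (hull_lt hu).
  rewrite !slE // => sl; have [hu' hq' aq'] := hull_pop hu hq aq sl.
  by split=> //; [lia|rewrite hq' leqW|left].
move=> d s' sm /= [id hu hq aq st]; rewrite (same_nvar sm (x := 3%N) isT) => lt.
exists (nvar s' 5); split=> //; rewrite -/N.
by case: st => // ?; rewrite /N in lt *; lia.
Qed.

Lemma reach_proj2 s h : let N := nvar s 3 in
  hull (rarr s 9) (narr s 6) h -> narr s 6 h = N ->
  (forall r, (r <= N)%N -> rarr s 10 r = r%:R) ->
  (forall t u, (t < N)%N -> (u < N)%N -> narr s 4 t = narr s 4 u -> t = u) ->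
  reach prog_proj2 s
  (for_cost init_proj2 (nlt (NVar 4) (NVar 3)) body_proj2 N)
  (fun s' => forall t, (t < N)%N ->
     rarr s' 6 (narr s 4 t) = Num.max (hull_fit (rarr s 9) (narr s 6) t) 0).
Proof.
move=> N hu hN s10 inj; set st := narr s 6; set A := narr s 4.
apply: (reach_for_init (I := fun d s' => [/\ (nvar s' 4 + d = N)%N,
    nvar s' 5 = hull_block st (nvar s' 4) &
    forall t, (t < nvar s' 4)%N ->
     rarr s' 6 (A t) = Num.max (hull_fit (rarr s 9) st t) 0])) => //.
- move=> d s' sm [id i5 i6] /=; rewrite (same_nvar sm (x := 3%N) isT) -ltnNge => lt.
  exists d.-1; first lia.
  have n6 := same_narr sm (r := 6%N) isT; have n4 := same_narr sm (r := 4%N) isT.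
  have [bh /andP[l1 l2]] := hull_blockP hu hN lt.
  have stm : (st (hull_block st (nvar s' 4)).+1 <= N)%N.
    by rewrite -hN; apply: (hull_mono hu).
  have slE : (rarr s' 9 (narr s' 6 (nvar s' 5 + 1)%N) - rarr s' 9 (narr s' 6 (nvar s' 5))) /
      (rarr s' 10 (narr s' 6 (nvar s' 5 + 1)%N) - rarr s' 10 (narr s' 6 (nvar s' 5))) =
      hull_fit (rarr s 9) st (nvar s' 4).
    rewrite (same_rarr sm (r := 9%N) isT) (same_rarr sm (r := 10%N) isT) n6 i5 addn1.
    by rewrite !s10 // (leq_trans l1) // ltnW.
  have fin v : v = Num.max (hull_fit (rarr s 9) st (nvar s' 4)) 0 ->
      forall t, (t < (nvar s' 4).+1)%N ->
      upd_arr (rarr s') 6 (A (nvar s' 4)) v 6%N (A t) = Num.max (hull_fit (rarr s 9) st t) 0.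
    move=> -> t; rewrite ltnS leq_eqVlt; simp => /predU1P[->|ll]; first by rewrite eqxx.
    rewrite ifN ?i6 //; apply/eqP => /inj; lia.
  simp; rewrite slE.
  by case: (leP 0 (hull_fit _ _ _)) => f0; simp; rewrite n6 n4 -/A -/st i5 !addn1;
    case: ifP => hb; simp; rewrite ?i5 ?addn1 ?hb; split=> //; try lia;
    apply: fin; move: f0; case: leP => //; lra.
move=> d s' sm [id i5 i6] /=; rewrite (same_nvar sm (x := 3%N) isT) => lt t tN.
by apply: i6; lia.
Qed.

Lemma reach_dual s : reach prog_dual s
  (for_cost (NSet 4 (NConst 0)) (nlt (NVar 4) (NVar 3)) body_dual (nvar s 3))
  (fun s' => forall q, (q < nvar s 3)%N ->
    rarr s' 7 q = rarr s 4 q + rarr s 5 q - rarr s 6 q).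
Proof.
apply: (reach_for_init (I := fun d s' => (nvar s' 4 + d = nvar s 3)%N /\
    forall q, (q < nvar s' 4)%N -> rarr s' 7 q = rarr s 4 q + rarr s 5 q - rarr s 6 q)) => //.
- move=> d s' sm [id i1] /=; rewrite (same_nvar sm (x := 3%N) isT) => lt.
  exists d.-1; first lia.
  simp; rewrite (same_rarr sm (r := 4%N) isT) (same_rarr sm (r := 5%N) isT).
  rewrite (same_rarr sm (r := 6%N) isT) addn1; split; first lia.
  move=> q; rewrite ltnS leq_eqVlt => /predU1P[->|ll]; first by rewrite eqxx.
  by rewrite ltn_eqF // i1.
move=> d s' sm [id i1] /=; rewrite (same_nvar sm (x := 3%N) isT) => lt q qN.
by apply: i1; lia.
Qed.

End Phases.

(** * Bottom-up merge sort *)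

Definition sort_cost N :=
  (2 + (up_log 2 N).+1 * (bcost (nlt (NVar 9) (NVar 3)) +
    (for_cost init_merge (nlt (NVar 4) (NVar 3)) body_merge N +
     (for_cost (NSet 4 (NConst 0)) (nlt (NVar 4) (NVar 3)) body_copy N +
      run_cost (NSet 9 (NAdd (NVar 9) (NVar 9)))))).+1)%N.

Section Sort.
Variable R : realType.
Implicit Types s : state R.

(** After l passes the width is 2 ^ l, so [up_log 2 N] passes suffice. The leading 2 in [sort_cost]
    pays for setting the width to 1. *)
Lemma reach_sort s : let N := nvar s 3 in
  (forall q, (q < N)%N -> narr s 4 q = q) ->
  reach prog_sort s (sort_cost N)
  (fun s' => perm_eq (slice (narr s' 4) 0 N) (iota 0 N) /\
    forall t u, (t <= u < N)%N ->
      lexle (narr s 3) (rarr s 8) (narr s' 4 t) (narr s' 4 u)).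
Proof.
move=> N A0; set leT := lexle (narr s 3) (rarr s 8).
pose I d s' := exists l, [/\ (l + d = up_log 2 N)%N, nvar s' 9 = (2 ^ l)%N,
    perm_eq (slice (narr s' 4) 0 N) (iota 0 N) & blocks_sorted leT (2 ^ l) (narr s' 4) N].
apply: reach_seq (reach_run (Q := I (up_log 2 N)) _ _) _ => //.
  exists 0%N; simp; split=> //.
    rewrite (eq_slice (B := id)); last by move=> t; exact: A0.
    by rewrite /slice map_id subn0.
  move=> x y xy yN; rewrite expn0 !divn1 => ->.
  by have := @lexle_total _ (narr s 3) (rarr s 8) (narr s 4 y) (narr s 4 y); rewrite orbb.
move=> s1 sm1 I1.
apply: (@reach_weaken _ _ _ ((up_log 2 N).+1 * _) _ (fun s' =>
    ~~ beval s' (nlt (NVar 9) (NVar 3)) /\ exists d, nvar s' 3 = N /\ I d s')).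
- apply: (reach_while (I := fun d s' => nvar s' 3 = N /\ I d s')).
    by rewrite (same_nvar sm1 (x := 3%N) isT).
  move=> d s2 sm2 [N2 [l [ld w2 p2 b2]]] /=; rewrite N2 w2 -ltnNge => lt.
  have s23 : narr s2 3 = narr s 3.
    by rewrite (same_narr sm2 (r := 3%N) isT) (same_narr sm1 (r := 3%N) isT).
  have s28 : rarr s2 8 = rarr s 8.
    by rewrite (same_rarr sm2 (r := 8%N) isT) (same_rarr sm1 (r := 8%N) isT).
  have mb : blocks_sorted (lexle (narr s2 3) (rarr s2 8)) (nvar s2 9) (narr s2 4) (nvar s2 3).
    by rewrite s23 s28 w2 N2.
  have w0 : (0 < nvar s2 9)%N by rewrite w2 expn_gt0.
  have lN : (l < up_log 2 N)%N.
    rewrite ltnNge; apply/negP => le; move: lt; rewrite ltnNge.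
    by rewrite (leq_trans (up_logP N (isT : 1 < 2)%N)) // leq_pexp2l.
  have := reach_merge w0 mb; rewrite s23 s28 N2 w2 -/leT => rm.
  apply: reach_seq rm _ => s3 sm3 [p3 b3].
  have N3 : nvar s3 3 = N by rewrite (same_nvar sm3 (x := 3%N) isT).
  have := reach_copy s3; rewrite N3 => rc.
  apply: reach_seq rc _ => s4 sm4 c4.
  apply: reach_run => //; exists d.-1; first lia.
  split; first by simp; rewrite (same_nvar sm4 (x := 3%N) isT).
  have w4 : nvar s4 9 = (2 ^ l)%N.
    by rewrite (same_nvar sm4 (x := 9%N) isT) (same_nvar sm3 (x := 9%N) isT).
  exists l.+1; simp; rewrite w4 addnn -mul2n -expnS in b3 *.
  split=> //; first lia.
    by rewrite (eq_slice (B := narr s3 5)) // (perm_trans p3).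
  move=> x y xy yN; rewrite !c4 ?(leq_ltn_trans xy) //; exact: b3.
- exact: leqnn.
move=> s2 _ [/= + [d [N2 [l [_ w2 p2 b2]]]]]; rewrite N2 w2 negbK => Nw.
split=> // t u /andP[tu uN]; apply: b2 => //.
(* The width is now at least N, so all positions lie in block 0. *)
by rewrite !divn_small //; apply: leq_trans Nw => //; exact: leq_ltn_trans uN.
Qed.

End Sort.

(** * The complete program and its linearithmic cost *)

Definition prog_admm : cmd :=
  (prog_dims;; prog_width;; prog_residuals;; prog_proj1;; prog_ranks;; prog_sort;;
   prog_sums;; prog_hull;; prog_proj2;; prog_dual)%cmd.

Definition admm_cost m n k N :=
  (for_cost init_dims (nlt (NVar 4) (NVar 0)) body_dims m +
  (for_cost init_width (nlt (NVar 4) (NVar 1)) body_width n +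
  (for_cost init_residuals (nlt (NVar 4) (NVar 3)) body_residuals N +
  (for_cost init_proj1 (nlt (NVar 4) (NVar 3)) body_proj1 N +
  (for_cost (NSet 4 (NConst 0)) (nlt (NVar 4) (NVar 2)) body_ranks k +
  (sort_cost N +
  (for_cost init_sums (nlt (NVar 4) (NVar 3)) body_sums N +
  (for_cost init_hull (BNle (NVar 4) (NVar 3)) body_hull (2 * N) +
  (for_cost init_proj2 (nlt (NVar 4) (NVar 3)) body_proj2 N +
   for_cost (NSet 4 (NConst 0)) (nlt (NVar 4) (NVar 3)) body_dual N)))))))))%N.

(** The factor 2 accommodates the hull scan. Since N > 0, [d.+1] is at most 3N, whence the
    coefficient is the cost of the loop at d = 2. *)
Lemma for_cost_le c0 b c d N : (0 < N)%N -> (d <= 2 * N)%N ->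
  (for_cost c0 b c d <= for_cost c0 b c 2 * N)%N.
Proof.
move=> N0 dN; rewrite /for_cost mulnDl leq_add ?leq_pmulr //.
by rewrite mulnAC leq_mul2r orbC; apply/orP; left; lia.
Qed.

(** The successor keeps the bound positive at N = 1, where [up_log] vanishes, and lets it absorb
    linear costs. *)
Definition linlog (f : nat -> nat -> nat -> nat -> nat) : Prop :=
  exists K, forall m n k N, (0 < N)%N -> (m <= N)%N -> (n <= N)%N -> (k <= N)%N ->
    (f m n k N <= K * (N * (up_log 2 N).+1))%N.

Lemma linlogD f g : linlog f -> linlog g ->
  linlog (fun m n k N => f m n k N + g m n k N)%N.
Proof.
move=> [Kf Hf] [Kg Hg]; exists (Kf + Kg)%N => m n k N N0 mN nN kN.
by rewrite mulnDl leq_add ?Hf ?Hg.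
Qed.

Lemma linlog_for c0 b c d :
  (forall m n k N, (m <= N)%N -> (n <= N)%N -> (k <= N)%N -> (d m n k N <= 2 * N)%N) ->
  linlog (fun m n k N => for_cost c0 b c (d m n k N)).
Proof.
move=> H; exists (for_cost c0 b c 2) => m n k N N0 mN nN kN.
apply: leq_trans (for_cost_le c0 b c N0 (H m n k N mN nN kN)) _.
by rewrite leq_mul2l leq_pmulr // orbT.
Qed.

Lemma linlog_sort : linlog (fun _ _ _ N => sort_cost N).
Proof.
have H (z w x1 x2 y1 y2 N L : nat) : (0 < N)%N -> (0 < L)%N ->
    (x1 <= y1 * N)%N -> (x2 <= y2 * N)%N ->
    (2 + L * (z + (x1 + (x2 + w))).+1 <= (2 + (z + (y1 + (y2 + w))).+1) * (N * L))%N.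
  move=> N0 L0 h1 h2; rewrite mulnDl leq_add //.
    by rewrite leq_pmulr // muln_gt0 N0.
  rewrite mulnA [X in (_ <= X)%N]mulnC leq_mul2l; apply/orP; right.
  by have := leq_pmulr z N0; have := leq_pmulr w N0; lia.
eexists => _ _ _ N N0 _ _ _; apply: H => //.
  by apply: (@for_cost_le _ _ _ _ N); lia.
by apply: (@for_cost_le _ _ _ _ N); lia.
Qed.

Lemma linlog_admm : linlog admm_cost.
Proof.
rewrite /admm_cost; do 5![apply: linlogD; first by apply: linlog_for => m n k N *; lia].
apply: linlogD; first exact: linlog_sort.
do 3![apply: linlogD; first by apply: linlog_for => m n k N *; lia].
by apply: linlog_for => m n k N *; lia.
Qed.

(** * Assembly of one ADMM round *)

Section Correctness.
Variable R : realType.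

Lemma probability_vector_gt0 m (a : 'cV[R]_m) : probability_vector a -> (0 < m)%N.
Proof.
by case: m a => // a [_]; rewrite big_ord0 => /esym/eqP; rewrite oner_eq0.
Qed.

Lemma reach_admm m n k (a : 'cV[R]_m) (b : 'cV[R]_n) (idx : 'I_k -> 'I_m * 'I_n)
    (D : 'M[R]_(m, n)) (rho : R) (Z M : 'M[R]_(m, n)) (s : state R) :
  probability_vector a -> probability_vector b -> injective idx ->
  admm_input s a b idx D rho Z M ->
  let X' := admm_X a b D rho Z M in
  let Z' := admm_Z idx X' M in
  reach prog_admm s (admm_cost m n k (m * n))
    (fun s' => admm_output s' X' Z' (admm_M X' Z' M)).
Proof.
move=> pa pb inj [[nm nn nk] sidx srho [sa sb sD sZ sM]] X' Z'.
have m0 := probability_vector_gt0 pa; have n0 := probability_vector_gt0 pb.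
have N0 : (0 < m * n)%N by rewrite muln_gt0 m0.
have := reach_dims s; rewrite nm nn => r1.
apply: (reach_seq r1) => {r1} s1 sm1 [d3 d1 d2].
have := reach_width s1; rewrite (same_nvar sm1 (x := 1%N) isT) nn => r2.
apply: (reach_seq r2) => {r2} s2 sm2 w2; have sm12 := same_seq sm1 sm2.
have n21 : nvar s2 1 = n by rewrite (same_nvar sm12 (x := 1%N) isT).
have n23 : nvar s2 3 = (m * n)%N by rewrite (same_nvar sm2 (x := 3%N) isT).
have := @reach_residuals _ s2; rewrite n21 n23 => /(_ n0).
set y := fun q => _ => r3.
apply: (reach_seq r3) => {r3} s3 sm3 [y5 u0 v1 t3]; have sm13 := same_seq sm12 sm3.
have n31 : nvar s3 1 = n by rewrite (same_nvar sm13 (x := 1%N) isT).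
have n33 : nvar s3 3 = (m * n)%N by rewrite (same_nvar sm3 (x := 3%N) isT).
have := @reach_proj1 _ s3; rewrite n31 n33 => /(_ n0).
pose x q := rarr s3 5 q + rarr s3 0 (q %/ n)%N / rvar s3 2
  + rarr s3 1 (q %% n)%N / rvar s3 1 - rvar s3 3 / (rvar s3 2 * rvar s3 1).
move=> r4; apply: (reach_seq r4) => {r4} s4 sm4 x4; have sm14 := same_seq sm13 sm4.
have n43 : nvar s4 3 = (m * n)%N by rewrite (same_nvar sm4 (x := 3%N) isT).
have s44 : rarr s4 4 = rarr s 4 by rewrite (same_rarr sm14 (r := 4%N) isT).
have s34 : rarr s3 4 = rarr s 4 by rewrite (same_rarr sm13 (r := 4%N) isT).
have xE (i : 'I_m) (j : 'I_n) : x (i * n + j)%N = X' i j.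
  have yE (p : 'I_m) (q : 'I_n) : y (p * n + q)%N = (Z - M - rho^-1 *: D) p q.
    rewrite /y (same_rarr sm12 (r := 3%N) isT) (same_rarr sm12 (r := 4%N) isT).
    rewrite (same_rarr sm12 (r := 2%N) isT) (same_rvar sm12 (x := 0%N) isT).
    by rewrite sZ sM sD srho !mxE mulrC.
  rewrite /X' /admm_X (Proj_C1 _ m0 n0 pa.2 pb.2) mxE /x y5 ?lin_lt // yE.
  rewrite (same_rvar sm3 (x := 1%N) isT) (same_rvar sm3 (x := 2%N) isT).
  rewrite w2 (same_rvar sm2 (x := 1%N) isT) d1 t3.
  rewrite divnMDl // divn_small // addn0 modnMDl modn_small // u0 v1.
  rewrite (same_rarr sm12 (r := 0%N) isT) (same_rarr sm12 (r := 1%N) isT).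
  (* A column vector is stored as a matrix with one column, so its entry i sits at address i * 1 +
     0. *)
  have := sa i ord0; rewrite muln1 addn0 => ->.
  have := sb j ord0; rewrite muln1 addn0 => ->.
  rewrite sum_row sum_col -sum_lin /res_row /res_col.
  under eq_bigr do rewrite yE.
  under [X in _ + (_ - X) / _ - _]eq_bigr do rewrite yE.
  congr (_ - (1 - _) / _); apply: eq_bigr => p _; apply: eq_bigr => q _.
  exact: yE.
have idxE (l : 'I_k) : (narr s4 2 (narr s4 0 l) + narr s4 1 l)%N =
    ((idx l).1 * n + (idx l).2)%N.
  rewrite (same_narr sm14 (r := 0%N) isT) (same_narr sm14 (r := 1%N) isT).
  have [-> ->] := sidx l; have smd := same_seq (same_seq sm2 sm3) sm4.
  by rewrite (same_narr smd (r := 2%N) isT) d2.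
have n42 : nvar s4 2 = k by rewrite (same_nvar sm14 (x := 2%N) isT).
have := @reach_ranks _ s4; rewrite n42 => r5.
have {}r5 := r5 _; apply: (reach_seq (r5 _)) => {r5}.
  move=> l l' lk lk'; have := idxE (Ordinal lk); have := idxE (Ordinal lk').
  move=> /= -> -> /lin_inj; rewrite -!surjective_pairing => /inj e.
  by have := congr1 val e.
move=> s5 sm5 [k1 k2].
have n53 : nvar s5 3 = (m * n)%N by rewrite (same_nvar sm5 (x := 3%N) isT).
have w5 : rarr s5 8 = rarr s4 8 by rewrite (same_rarr sm5 (r := 8%N) isT).
have := reach_sort (s := s5); rewrite n53 => r6.
apply: (reach_seq (r6 _)) => {r6}.
  by move=> q qN; rewrite (same_narr sm5 (r := 4%N) isT); have [] := x4 q qN.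
move=> s6 sm6 [pA sA].
have n63 : nvar s6 3 = (m * n)%N by rewrite (same_nvar sm6 (x := 3%N) isT).
have := reach_sums s6; rewrite n63 => r7.
apply: (reach_seq r7) => {r7} s7 sm7 F7.
have n73 : nvar s7 3 = (m * n)%N by rewrite (same_nvar sm7 (x := 3%N) isT).
have := reach_hull (s := s7); rewrite n73 => r8.
apply: (reach_seq (r8 N0 _)) => {r8}; first by move=> r /F7[].
move=> s8 sm8 [h [hu hN]]; have sm78 := same_seq sm7 sm8.
have n83 : nvar s8 3 = (m * n)%N by rewrite (same_nvar sm8 (x := 3%N) isT).
have A8 : narr s8 4 = narr s6 4 by rewrite (same_narr sm78 (r := 4%N) isT).
have F8 : rarr s8 9 = rarr s7 9 by rewrite (same_rarr sm8 (r := 9%N) isT).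
have := @reach_proj2 _ s8 h; rewrite n83 F8 A8 => r9.
apply: (reach_seq (r9 hu hN _ _)) => {r9}.
- by move=> r /F7[_]; rewrite (same_rarr sm8 (r := 10%N) isT).
- by move=> t u tN uN; apply: perm_slice_inj pA tN uN.
move=> s9 sm9 z9; have sm59 := same_seq (same_seq (same_seq sm5 sm6) sm78) sm9.
have n93 : nvar s9 3 = (m * n)%N by rewrite (same_nvar sm9 (x := 3%N) isT).
have := reach_dual s9; rewrite n93 => r10.
apply: (reach_weaken r10 (leqnn _)) => s10 sm10 m10.
have sm510 := same_seq sm59 sm10.
have sm110 := same_seq sm14 sm510.
have s105 : rarr s10 5 = rarr s4 5 by rewrite (same_rarr sm510 (r := 5%N) isT).
have s106 : rarr s10 6 = rarr s9 6 by rewrite (same_rarr sm10 (r := 6%N) isT).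
have X5 (i : 'I_m) (j : 'I_n) : rarr s4 5 (i * n + j)%N = X' i j.
  by rewrite -xE; have [-> _ _ _] := x4 _ (lin_lt i j).
have Z6 (i : 'I_m) (j : 'I_n) : rarr s9 6 (i * n + j)%N = Z' i j.
  rewrite /Z' /admm_Z (@Proj_C2 _ _ _ _ idx (narr s5 3) (narr s6 4) (rarr s5 8)
    (hull_fit (rarr s7 9) (narr s8 6)) (rarr s9 6)) ?mxE //.
  - by move=> l; rewrite -idxE k1.
  - move=> q qN; case: (k2 q) => [[l lk ->] _|-> ]; last by have [_ _ ->] := x4 q qN.
    by exists (Ordinal lk); rewrite -idxE.
  - apply: hull_isotonic hu hN _ => r rN; have [-> _] := F7 r rN.
    by rewrite (same_rarr sm6 (r := 8%N) isT).
  - move=> p q; rewrite w5 mxE -xE -sM -s34.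
    by have [_ -> _ _] := x4 _ (lin_lt p q).
split=> i j; rewrite ?s105 ?s106 ?X5 ?Z6 //.
rewrite m10 ?lin_lt // Z6 (same_rarr sm59 (r := 5%N) isT) X5.
by rewrite (same_rarr sm59 (r := 4%N) isT) s44 sM !mxE.
Qed.

End Correctness.

(** Writing [up_log 2 N] as L + 1, one has 2 ^ L < N, so L ln 2 <= ln N; the two remaining copies of
    ln 2 are at most ln N each because N >= 2. Hence the 3. *)
Lemma up_log2_le_ln (R : realType) N : (1 < N)%N ->
  (up_log 2 N).+1%:R * ln 2 <= 3 * ln N%:R :> R.
Proof.
move=> N1; have L0 : (0 < up_log 2 N)%N by rewrite up_log_gt0.
have := up_log_gtn (isT : 1 < 2)%N N1; case: (up_log 2 N) L0 => // L _ /= lt.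
have N0 : 0 < N%:R :> R by rewrite ltr0n ltnW.
have h1 : L%:R * ln 2 <= ln N%:R :> R.
  rewrite mulrC mulr_natr -lnXn // -natrX ler_ln ?posrE ?ltr0n ?expn_gt0 ?(ltnW N1) //.
  by rewrite ler_nat ltnW.
have h2 : ln 2 <= ln N%:R :> R by rewrite ler_ln ?posrE // ler_nat.
by rewrite -[L.+2]addn2 natrD mulrDl; lra.
Qed.

Theorem proposition3p5 (R : realType) :
  exists (P : cmd) (c : R),
    forall (m n k : nat) (a : 'cV[R]_m) (b : 'cV[R]_n)
           (idx : 'I_k -> 'I_m * 'I_n) (D : 'M[R]_(m, n)) (rho : R)
           (Z M : 'M[R]_(m, n)),
      probability_vector a -> probability_vector b -> injective idx ->
      0 < rho ->
      let X' := admm_X a b D rho Z M in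
      let Z' := admm_Z idx X' M in
      let M' := admm_M X' Z' M in
      forall s : state R, admm_input s a b idx D rho Z M ->
      exists (t : nat) (s' : state R),
        [/\ exec P s t s',
            admm_output s' X' Z' M'
          & (1 < m * n)%N -> t%:R <= c * (m * n)%:R * ln (m * n)%:R].
Proof.
have [K HK] := linlog_admm; have ln2 : 0 < ln 2 :> R by rewrite ln_gt0 // ltr1n.
(* K bounds the time per unit of [N * (up_log 2 N).+1], and 3 / ln 2 converts this to the natural
   logarithm. *)
exists prog_admm, (K%:R * 3 / ln 2) => m n k a b idx D rho Z M pa pb inj _ X' Z' M' s inp.
have [t [s' [e tK out]]] := reach_admm pa pb inj inp.
exists t, s'; split=> // N1.
have m0 := probability_vector_gt0 pa; have n0 := probability_vector_gt0 pb.
(* Distinctness of the pairs bounds k, and with it the cost of writing the ranks. *)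
have kN : (k <= m * n)%N by have := leq_card idx inj; rewrite card_prod !card_ord.
have {tK} := leq_trans tK (HK _ _ _ _ (ltnW N1) (leq_pmulr m n0) (leq_pmull n m0) kN).
rewrite -(ler_nat R) (natrM _ K) (natrM _ (m * n)) => /le_trans; apply.
have := up_log2_le_ln R N1; rewrite -ler_pdivlMr // => h.
rewrite -!mulrA ler_wpM2l //.
have -> : 3 * ((ln 2)^-1 * ((m * n)%:R * ln (m * n)%:R)) =
    (m * n)%:R * (3 * ln (m * n)%:R / ln 2) :> R by ring.
by rewrite ler_wpM2l.
Qed.
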